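(* Let $\mu$ be a non-trivial positive measure on $\mathbb{R}$ with finite moments whose recurrence coefficients $(a_n,b_n)_{n\ge1}$ satisfy $$a_n\to a\neq0,\qquad b_n\to b,\qquad \sum_{n=1}^\infty\left(|a_{n+1}-a_n|+|b_{n+1}-b_n|\right)<\infty.$$ Then the essential support of $\mu$ is $[b-2a,b+2a]$. Moreover, if $x_1,\dots,x_k\in\mathbb{R}\setminus[b-2a,b+2a]$ are finitely many distinct points, $\gamma_1,\dots,\gamma_k>0$, and $$\mu_k=\mu+\sum_{j=1}^k\gamma_j\delta_{x_j},$$ then the recurrence coefficients $(\tilde a_n,\tilde b_n)_{n\ge1}$ of $\mu_k$ satisfy $\tilde a_n\to a$, $\tilde b_n\to b$ (with the same limits $a,b$) and $\sum_{n=1}^\infty\left(|\tilde a_{n+1}-\tilde a_n|+|\tilde b_{n+1}-\tilde b_n|\right)<\infty$.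
   Context: A measure $\mu$ on $\mathbb{R}$ is non-trivial if its support is infinite; we assume $\int|x|^n\,d\mu<\infty$ for all $n\in\mathbb{N}$. The orthonormal polynomials $p_n$ (degree $n$, positive leading coefficient) are obtained by applying Gram--Schmidt to $1,x,x^2,\dots$ in $L^2(\mathbb{R},d\mu)$. The recurrence coefficients $(a_n,b_n)_{n\ge1}$ of $\mu$, with $a_n>0$ and $b_n\in\mathbb{R}$, are those in $$xp_n(x)=a_{n+1}p_{n+1}(x)+b_{n+1}p_n(x)+a_np_{n-1}(x),\qquad n\ge0,\quad p_{-1}=0.$$ The recurrence coefficients of $\mu_k$ are defined in the same way from the orthonormal polynomials of $\mu_k$. The essential support of $\mu$ is the support of $\mu$ with its isolated points removed. $\delta_x$ is the unit point mass at $x$. The points $x_j$ may or may not already be point masses of $\mu$. *)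

(* Defs.v *)
From HB Require Import structures.
From mathcomp Require Export all_boot all_order all_algebra.
From mathcomp Require Export all_classical all_reals all_analysis.

Set Implicit Arguments.
Unset Strict Implicit.
Unset Printing Implicit Defensive.

Export Order.TTheory GRing.Theory Num.Theory.
Export numFieldNormedType.Exports.
#[global] Open Scope classical_set_scope.
#[global] Open Scope ring_scope.

Section Defs.
Context {R : realType}.
Implicit Type mu : {measure set (measurableTypeR R) -> \bar R}.

Definition msupport mu : set R :=
  [set x | forall U : set R, open U -> U x -> (0 < mu U)%E].

Definition nontrivial_measure mu : Prop := infinite_set (msupport mu).

Definition essential_support mu : set R :=
  msupport mu `\` isolated (msupport mu).

(* The case n = 0 says that mu is finite. *)
Definition finite_moments mu : Prop :=
  forall n : nat, (\int[mu]_x (`|x| ^+ n)%:E < +oo)%E.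

Definition poly_inner mu (p q : {poly R}) : R :=
  \int[mu]_x (p.[x] * q.[x]).

Definition poly_normalize mu (p : {poly R}) : {poly R} :=
  (Num.sqrt (poly_inner mu p p))^-1 *: p.

(* The sequence p_0, ..., p_(n-1) obtained from 1, 'X, ..., 'X^(n-1). *)
Fixpoint gram_schmidt mu (n : nat) : seq {poly R} :=
  if n is m.+1 then
    let s := gram_schmidt mu m in
    rcons s (poly_normalize mu
      ('X^m - \sum_(q <- s) poly_inner mu q 'X^m *: q))
  else [::].

Definition orthonormal_poly mu (n : nat) : {poly R} :=
  (gram_schmidt mu n.+1)`_n.

(* The sequences are indexed from 1: a 0 and b 0 are never used. *)
Definition recurrence_coefficients mu (a b : nat -> R) : Prop :=
  let p := orthonormal_poly mu in
  (forall n, (1 <= n)%N -> 0 < a n) /\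
  (forall n, 'X * p n = a n.+1 *: p n.+1 + b n.+1 *: p n
                        + (if n is m.+1 then a n *: p m else 0)).

Definition bounded_variation_coefficients (a b : nat -> R) : Prop :=
  (\sum_(1 <= n <oo) (`|a n.+1 - a n| + `|b n.+1 - b n|)%:E < +oo)%E.

End Defs.

Section AddPointMasses.
Context {R : realType}.
Variables (mu : {measure set (measurableTypeR R) -> \bar R}) (k : nat).
Variables (x : 'I_k -> R) (gamma : 'I_k -> {posnum R}).
Local Open Scope ereal_scope.

Definition add_point_masses (A : set (measurableTypeR R)) : \bar R :=
  mu A + \sum_(j < k) (gamma j)%:num%:E * dirac (x j : measurableTypeR R) A.

Let mass (n : nat) : {measure set (measurableTypeR R) -> \bar R} :=
  if insub n is Some j
  then mscale ((gamma j)%:num%:nng)%R (dirac (x j : measurableTypeR R))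
  else mzero.

Let add_point_massesE :
  add_point_masses = measure_add mu (msum mass k).
Proof.
apply/funext => A; rewrite measure_addE /add_point_masses /msum.
by congr (_ + _); apply: eq_bigr => j _; rewrite /mass valK.
Qed.

Let add_point_masses0 : add_point_masses set0 = 0.
Proof. by rewrite add_point_massesE; exact: measure0. Qed.

Let add_point_masses_ge0 A : 0 <= add_point_masses A.
Proof. by rewrite add_point_massesE; exact: measure_ge0. Qed.

Let add_point_masses_sigma_additive : semi_sigma_additive add_point_masses.
Proof.
by rewrite add_point_massesE; exact: measure_semi_sigma_additive.
Qed.

HB.instance Definition _ := isMeasure.Build _ _ _ add_point_masses
  add_point_masses0 add_point_masses_ge0 add_point_masses_sigma_additive.

End AddPointMasses.

(* Main.v *)
Require Import Defs.
From HB Require Import structures.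
From mathcomp Require Import measurable_realfun ring lra zify.

(* Everything is expressed through the Jacobi matrix, that is, through the
   coefficients c_n = <f, p_n> of a polynomial f.

   Essential support.  If f is orthogonal to p_0, ..., p_(N-1) with N large,
   the banded form of the Jacobi matrix gives |(x - b) f| <= (2a + e) |f|.  If
   the support had infinitely many points with |x - b| > c > 2a, this would be
   violated by f = q ((x - b)^2 / c^2)^m with deg q <= N and m large, as the
   factor is small where |x - b| < c and at least 1 on those points.  Conversely,
   for |x - b| < 2a the sequence c_(n+1) = ((x - b) / a) c_n - c_(n-1) is bounded,
   and its long truncations are approximate eigenvectors, so x is in the support.

   Point masses.  One mass g at x is added at a time.  Put
   S_n = 1/g + sum_(j < n) p_j(x)^2; the new recurrence coefficients are explicit
   in S_n/S_(n+1) and p_n(x) p_(n+1)(x)/S_(n+1).  Since |x - b| > 2a, the recurrence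
   for p_n(x) is asymptotically hyperbolic, with multipliers l, 1/l, |l| > 1:
   either sum p_n(x)^2 converges, or p_(n+1)(x)/p_n(x) tends to l.  In the first
   case S_n converges; in the second, both p_(n+1)(x)/p_n(x) and
   S_(n+1)/p_n(x)^2 are eventually iterates of contractions whose coefficients
   have bounded variation, so they have bounded variation. *)

Set Implicit Arguments.
Unset Strict Implicit.
Unset Printing Implicit Defensive.

(** * Summable sequences and sequences of bounded variation *)

Section Summable.
Context {R : realType}.
Implicit Types (u v e f : nat -> R).

(** Summability is a uniform bound on partial sums, so that comparisons reduce to inequalities
    between finite sums. *)
Definition abs_summable e := exists C : R, forall N, \sum_(n < N) `|e n| <= C.

Definition bv u := abs_summable (fun n => u n.+1 - u n).

Lemma ler_sum_ord (g : nat -> R) m n : (forall k, 0 <= g k) -> (m <= n)%N ->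
  \sum_(k < m) g k <= \sum_(k < n) g k.
Proof.
by move=> g0 mn; rewrite -(subnKC mn) big_split_ord /= lerDl sumr_ge0.
Qed.

Lemma abs_summable_near e f C : abs_summable f ->
  (\forall n \near \oo, `|e n| <= C * `|f n|) -> abs_summable e.
Proof.
move=> [F fF] [N _ eN]; exists (\sum_(n < N) `|e n| + `|C| * F) => M.
have F0 : 0 <= F by have := fF 0%N; rewrite big_ord0.
apply: (@le_trans _ _ (\sum_(n < M) ((if (n < N)%N then `|e n| else 0) + `|C| * `|f n|))).
  apply: ler_sum => n _; case: ltnP => nN.
    by rewrite lerDl mulr_ge0.
  by rewrite add0r (le_trans (eN n nN))// ler_wpM2r// ler_norm.
rewrite big_split /= lerD//; last by rewrite -mulr_sumr ler_wpM2l ?fF.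
rewrite -big_mkcond /=; case: (leqP M N) => MN; last first.
  by rewrite -(big_ord_widen _ (fun i => `|e i|) (ltnW MN)).
apply: le_trans (@ler_sum_ord (fun i => `|e i|) _ _ (fun=> normr_ge0 _) MN).
by rewrite big_mkcond ler_sum// => n _; case: ifP.
Qed.

Lemma eq_summable e f : e =1 f -> abs_summable f -> abs_summable e.
Proof.
move=> ef sf; apply: (abs_summable_near (C := 1) sf); near=> n.
by rewrite ef mul1r.
Unshelve. all: by end_near. Qed.

Lemma abs_summableD e f : abs_summable e -> abs_summable f -> abs_summable (e \+ f).
Proof.
move=> [E eE] [F fF]; exists (E + F) => N.
rewrite (le_trans _ (lerD (eE N) (fF N)))// -big_split /= ler_sum// => n _.
exact: ler_normD.
Qed.

Lemma abs_summable_norm e : abs_summable e -> abs_summable (fun n => `|e n|).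
Proof. by move=> [E eE]; exists E => N; under eq_bigr do rewrite normr_id. Qed.

Lemma abs_summableS e : abs_summable e -> abs_summable (fun n => e n.+1).
Proof.
move=> [E eE]; exists E => N; apply: le_trans (eE N.+1).
by rewrite big_ord_recl /= lerDr.
Qed.

(** Summing the inequality from [N] on gives [T <= |e N| + F + q * T] for the partial sums [T], and
    [q < 1] lets [q * T] be absorbed. *)
Lemma abs_summable_contract q e f : q < 1 -> abs_summable f ->
  (\forall n \near \oo, `|e n.+1| <= q * `|e n| + `|f n|) -> abs_summable e.
Proof.
move=> q1 [F fF] [N _ eN].
have [k sk] : exists C, forall M, \sum_(n < M) `|e (N + n)%N| <= C.
  exists ((`|e N| + F) / (1 - q)) => M.
  rewrite ler_pdivlMr ?subr_gt0// mulrBr mulr1 lerBlDr.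
  have : \sum_(n < M.+1) `|e (N + n)%N| <= `|e N| + F + (\sum_(n < M) `|e (N + n)%N|) * q.
    rewrite big_ord_recl /= addn0 -addrA lerD2l mulr_suml.
    apply: (@le_trans _ _ (\sum_(n < M) (`|f (N + n)%N| + `|e (N + n)%N| * q))).
      apply: ler_sum => n _; rewrite /bump /= add1n addnS addrC mulrC.
      by rewrite (le_trans (eN _ _)) //= leq_addr.
    rewrite big_split /= lerD2r (le_trans _ (fF (N + M)%N))//.
    by rewrite big_split_ord /= lerDr sumr_ge0.
  by apply: le_trans; rewrite big_ord_recr /= lerDl.
exists (\sum_(n < N) `|e n| + k) => M.
apply: (@le_trans _ _ (\sum_(n < N + M) `|e n|)).
  by rewrite addnC big_split_ord /= lerDl sumr_ge0.
by rewrite big_split_ord /= lerD2l sk.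
Qed.

Lemma abs_summable_bv u : abs_summable u -> bv u.
Proof.
move=> su; have sn := abs_summable_norm su.
apply: (abs_summable_near (C := 1) (abs_summableD (abs_summableS sn) sn)).
near=> n; rewrite mul1r /= [leRHS]ger0_norm ?addr_ge0//.
exact: ler_normB.
Unshelve. all: by end_near. Qed.

Lemma bv_cst c : bv (fun=> c).
Proof.
by exists 0 => N; rewrite big1// => n _; rewrite subrr normr0.
Qed.

Lemma eq_bv u v : u =1 v -> bv v -> bv u.
Proof. by move=> uv; apply: eq_summable => n; rewrite !uv. Qed.

Lemma bvS u : bv u -> bv (fun n => u n.+1).
Proof. exact: abs_summableS. Qed.

Lemma bvSr u : bv (fun n => u n.+1) -> bv u.
Proof.
move=> [C uC]; exists (`|u 1%N - u 0%N| + C) => -[|N].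
  by rewrite big_ord0 addr_ge0// (le_trans _ (uC 0%N))// big_ord0.
by rewrite big_ord_recl lerD2l; exact: uC.
Qed.

Lemma bvD u v : bv u -> bv v -> bv (fun n => u n + v n).
Proof.
move=> su sv; apply: eq_summable (abs_summableD su sv) => n /=; ring.
Qed.

Lemma bvN u : bv u -> bv (fun n => - u n).
Proof.
move=> su; apply: (abs_summable_near (C := 1) su); near=> n.
by rewrite mul1r -opprD normrN.
Unshelve. all: by end_near. Qed.

Lemma bvB u v : bv u -> bv v -> bv (fun n => u n - v n).
Proof. by move=> su /bvN; exact: bvD. Qed.

Lemma bv_bounded u : bv u -> exists C, forall n, `|u n| <= C.
Proof.
move=> [C uC]; exists (`|u 0%N| + C) => n; apply: le_trans (lerD (lexx _) (uC n)).
elim: n => [|n IH]; first by rewrite big_ord0 addr0.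
rewrite big_ord_recr /= addrA (le_trans _ (lerD IH (lexx _)))//.
by rewrite -{1}(subrK (u n) (u n.+1)) addrC ler_normD.
Qed.

Lemma bv_cvg u : bv u -> cvgn u.
Proof.
move=> [C uC].
have : cvgn (series (fun n => `|u n.+1 - u n|)).
  apply: nondecreasing_is_cvgn; first by apply: nondecreasing_series => n _ _.
  by exists C => _ [n _ <-]; rewrite /series /= big_mkord.
move=> /(@normed_cvg _ _ (fun n => u n.+1 - u n)) cu.
have -> : u = (fun n => u 0%N + series (fun n => u n.+1 - u n) n).
  by apply/funext => n; rewrite /series /= telescope_sumr// addrC subrK.
by apply: is_cvgD => //; exact: is_cvg_cst.
Qed.

Lemma bvM u v : bv u -> bv v -> bv (fun n => u n * v n).
Proof.
move=> bu bw; have [U uU] := bv_bounded bu; have [V vV] := bv_bounded bw.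
have U0 : 0 <= U by exact: le_trans (uU 0%N).
have V0 : 0 <= V by exact: le_trans (vV 0%N).
pose f n := V * `|u n.+1 - u n| + U * `|v n.+1 - v n|.
have sf : abs_summable f.
  apply: abs_summableD; [apply: (abs_summable_near (C := V) bu)|
    apply: (abs_summable_near (C := U) bw)];
  by near=> n; rewrite normrM normr_id ger0_norm.
apply: (abs_summable_near (C := 1) sf); near=> n.
rewrite mul1r /f [leRHS]ger0_norm ?addr_ge0 ?mulr_ge0//.
rewrite (_ : _ - _ = v n.+1 * (u n.+1 - u n) + u n * (v n.+1 - v n)); last by ring.
by rewrite (le_trans (ler_normD _ _))// !normrM lerD// ler_wpM2r.
Unshelve. all: by end_near. Qed.

Lemma cvg_near_norm_gt u l c : u n @[n --> \oo] --> l -> c < `|l| ->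
  \forall n \near \oo, c < `|u n|.
Proof. by move=> /cvg_norm ul cl; exact: (cvgr_gt _ ul). Qed.

(** From some index on [|u n| > |l| / 2], where inversion is Lipschitz. Earlier zeros of [u] affect
    only finitely many differences. *)
Lemma bvV u l : bv u -> u n @[n --> \oo] --> l -> l != 0 ->
  bv (fun n => (u n)^-1).
Proof.
move=> bu ul l0; have nl0 : 0 < `|l| by rewrite normr_gt0.
apply: (abs_summable_near (C := (`|l| / 2)^-1 ^+ 2) bu).
have l2 : `|l| / 2 < `|l| by lra.
have [N _ uN] := cvg_near_norm_gt ul l2.
exists N => // n /= Nn.
have u1 := uN n Nn; have u2 := uN n.+1 (leq_trans Nn (leqnSn n)).
rewrite /= in u1 u2.
have p0 : 0 < `|l| / 2 by rewrite divr_gt0.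
have z1 : u n != 0 by rewrite -normr_gt0 (lt_trans p0).
have z2 : u n.+1 != 0 by rewrite -normr_gt0 (lt_trans p0).
rewrite (_ : _ - _ = (u n.+1)^-1 * (u n)^-1 * (u n - u n.+1)); last by field; rewrite z1.
rewrite !normrM (distrC (u n)) ler_wpM2r// expr2 !normfV ler_pM ?invr_ge0//.
  by rewrite lef_pV2 ?posrE ?ltW// (lt_trans p0).
by rewrite lef_pV2 ?posrE ?ltW// (lt_trans p0).
Qed.

Lemma bv_sqrt u l : bv u -> u n @[n --> \oo] --> l -> 0 < l ->
  bv (fun n => Num.sqrt (u n)).
Proof.
move=> bu ul l0.
apply: (abs_summable_near (C := (Num.sqrt (l / 2))^-1) bu).
have l2 : l / 2 < l by lra.
have [N _ uN] := cvgr_gt _ ul _ l2.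
exists N => // n /= Nn.
have u1 := uN n Nn; have u2 := uN n.+1 (leq_trans Nn (leqnSn n)).
rewrite /= in u1 u2.
have p0 : 0 < l / 2 by rewrite divr_gt0.
set s := Num.sqrt (u n); set t := Num.sqrt (u n.+1).
have s0 : 0 <= s by exact: sqrtr_ge0.
have t0 : Num.sqrt (l / 2) <= t by rewrite ler_wsqrtr// ltW.
have k0 : 0 < Num.sqrt (l / 2) by rewrite sqrtr_gt0.
rewrite ler_pdivlMl//.
have -> : u n.+1 - u n = (t + s) * (t - s).
  have <- : t ^+ 2 = u n.+1 by rewrite sqr_sqrtr// ltW// (lt_trans p0).
  have <- : s ^+ 2 = u n by rewrite sqr_sqrtr// ltW// (lt_trans p0).
  by ring.
rewrite normrM ler_wpM2r// ger0_norm ?addr_ge0//; first by rewrite (le_trans t0)// lerDl.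
by rewrite (le_trans _ t0)// ltW.
Qed.

(** Once [|f n| < (1 - q) * (eps / 2)], a step maps values below [eps / 2] to values below
    [eps / 2], and any excess over that level shrinks by the factor [q]. *)
Lemma cvg0_contract q e f : 0 <= q < 1 -> f n @[n --> \oo] --> 0 ->
  (\forall n \near \oo, 0 <= e n /\ e n.+1 <= q * e n + f n) ->
  e n @[n --> \oo] --> 0.
Proof.
move=> /andP[q0 q1] f0 eN.
apply/cvgr0Pnorm_lt => eps eps0.
have d0 : 0 < (1 - q) * (eps / 2) by rewrite mulr_gt0 ?subr_gt0// divr_gt0.
have fN : \forall n \near \oo, `|f n| < (1 - q) * (eps / 2).
  exact: (cvgr0_norm_lt _ f0 _ d0).
have [N _ H] := filterI eN fN.
have key k : e (N + k)%N <= eps / 2 + q ^+ k * e N.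
  elim: k => [|k IH]; first by rewrite addn0 expr0 mul1r lerDr ltW// divr_gt0.
  have [[_ h1] h2] := H (N + k)%N (leq_addr _ _).
  rewrite addnS (le_trans h1)//.
  have h3 := le_trans (ler_norm _) (ltW h2).
  have h4 := ler_wpM2l q0 IH.
  rewrite (le_trans (lerD h4 h3))// exprS; lra.
have qk : (fun k => q ^+ k * e N) @ \oo --> (0 : R).
  rewrite -(mul0r (e N)); apply: cvgM; last exact: cvg_cst.
  by apply: cvg_expr; rewrite ger0_norm.
have e2 : 0 < eps / 2 by rewrite divr_gt0.
have [M _ HM] := cvgr0_norm_lt _ qk _ e2.
exists (N + M)%N => // n /= nNM.
have Nn : (N <= n)%N by exact: leq_trans (leq_addr _ _) nNM.
have [[en0 _] _] := H n Nn.
rewrite ger0_norm//.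
have := key (n - N)%N; rewrite subnKC// => h.
have := HM (n - N)%N; rewrite /= leq_subRL// => /(_ nNM) h2.
have := le_lt_trans (ler_norm _) h2; lra.
Qed.

End Summable.

(** * Three-term recurrences with hyperbolic limit *)

Section HyperbolicRecurrence.
Context {R : realType}.

(* A perturbed diagonal system with multipliers [l] and [l^-1]: either the
   cone [|z| <= |w|] is entered, is invariant and attracts exponentially, or the
   orbit stays in the contracting cone [|w| < |z|] forever. *)
Lemma cone_dichotomy (l : R) (w z d : nat -> R) :
  1 < `|l| -> d n @[n --> \oo] --> 0 ->
  (forall n, w n = 0 -> z n <> 0) ->
  (forall n, `|w n.+1 - l * w n| <= d n * (`|w n| + `|z n|)) ->
  (forall n, `|z n.+1 - l^-1 * z n| <= d n * (`|w n| + `|z n|)) ->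
  (\forall n \near \oo, w n != 0) /\ (z n / w n @[n --> \oo] --> 0) \/
  abs_summable (fun n => z n ^+ 2) /\ \forall n \near \oo, `|w n| <= `|z n|.
Proof.
move=> l1 d0 wz0 hw hz.
have li0 : 0 <= `|l^-1| by [].
have li1 : `|l^-1| < 1 by rewrite normfV invf_lt1// (lt_trans ltr01).
have l_li : 1 - `|l^-1| <= `|l| - 1.
  have : `|l| * `|l^-1| = 1.
    by rewrite -normrM mulfV ?normr1// -normr_gt0 (lt_trans ltr01).
  nra.
pose m := `|l^-1|; rewrite -/m in li0 li1 l_li.
(* For [d n] below this bound, [m + 2 * d n < (1 + m) / 2 < 1 < |l| - 2 * d n]: this separates
   expansion from contraction in both cones. *)
have dl0 : 0 < (1 - m) / 4 by rewrite divr_gt0// subr_gt0.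
have [N _ dN] := cvgr0_norm_lt _ d0 _ dl0.
have dN' n : (N <= n)%N -> d n < (1 - m) / 4.
  by move=> /dN; exact: le_lt_trans (ler_norm _).
have hz' n : `|z n.+1| <= m * `|z n| + d n * (`|w n| + `|z n|).
  rewrite -lerBlDl (le_trans _ (hz n))// /m -normrM.
  exact: lerB_dist.
have hw' n : `|l| * `|w n| - d n * (`|w n| + `|z n|) <= `|w n.+1|.
  rewrite lerBlDr -lerBlDl (le_trans _ (hw n))// -normrM distrC.
  by rewrite (le_trans _ (lerB_dist _ _)).
have [[k [Nk zwk]]|nzw] := pselect (exists k, (N <= k)%N /\ `|z k| <= `|w k|).
  left.
  have cone n : (k <= n)%N -> `|z n| <= `|w n|.
    elim: n => [|n IH]; first by rewrite leqn0 => /eqP <-.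
    rewrite leq_eqVlt => /predU1P[<-//|]; rewrite ltnS => kn.
    have h := IH kn; have dn := dN' n (leq_trans Nk kn).
    have h1 := hz' n; have h2 := hw' n.
    have := normr_ge0 (z n); have := normr_ge0 (w n); nra.
  have w0 n : (k <= n)%N -> w n != 0.
    move=> kn; apply/eqP => wn0; apply: (wz0 n wn0).
    by have := cone n kn; rewrite wn0 normr0 normr_le0 => /eqP.
  split; first by exists k.
  apply/norm_cvg0P.
  (* Since [|w n|] does not decrease in the cone, the ratio [s = |z n| / |w n|] is followed by at
     most [m * s + 2 * |d n|]. *)
  apply: (@cvg0_contract _ m _ (fun n => 2 * `|d n|)); first by rewrite li0.
    rewrite -(mulr0 (2 : R)); apply: cvgM; first exact: cvg_cst.
    by rewrite -(normr0 R); exact: cvg_norm.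
  exists k => // n /= kn; split=> //.
  have h := cone n kn; have dn := dN' n (leq_trans Nk kn).
  have h1 := hz' n; have h2 := hw' n.
  have wn0 : 0 < `|w n| by rewrite normr_gt0 w0.
  have wn1 : 0 < `|w n.+1| by rewrite normr_gt0 w0// (leq_trans kn).
  have ww : `|w n| <= `|w n.+1| by have := normr_ge0 (z n); nra.
  have dd := ler_norm (d n).
  rewrite !normrM !normfV ler_pdivrMr//.
  have dn0 := normr_ge0 (d n).
  have e : `|z n| = `|z n| / `|w n| * `|w n| by rewrite divfK// gt_eqF.
  set s := `|z n| / `|w n| in e *.
  have s0 : 0 <= s by rewrite divr_ge0.
  have : `|z n.+1| <= (m * s + 2 * `|d n|) * `|w n|.
    have : d n * (`|w n| + `|z n|) <= `|d n| * (2 * `|w n|).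
      by rewrite (le_trans (ler_wpM2r _ dd))// ?addr_ge0// ler_wpM2l//; lra.
    by rewrite e in h1 *; lra.
  by move/le_trans; apply; rewrite ler_wpM2l// addr_ge0 ?mulr_ge0.
right.
have wz n : (N <= n)%N -> `|w n| < `|z n|.
  by move=> Nn; rewrite ltNge; apply/negP => h; apply: nzw; exists n.
split; last by exists N => // n /= /wz /ltW.
pose q := (1 + m) / 2.
have q1 : q < 1 by rewrite /q; lra.
have q0 : 0 <= q by rewrite /q; lra.
apply: (@abs_summable_contract _ (q ^+ 2) _ (fun=> 0)).
- by rewrite expr_lt1.
- by exists 0 => M; rewrite big1// => i _; rewrite normr0.
exists N => // n /= Nn; rewrite normr0 addr0 !normrX -exprMn.
have zz : `|z n.+1| <= q * `|z n|.
  have := hz' n; have := dN' n Nn; have := wz n Nn; have := normr_ge0 (w n).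
  rewrite /q; nra.
by rewrite lerXn2r // nnegrE mulr_ge0.
Qed.

(** [l] is the root of larger modulus of [l ^+ 2 - t * l + 1]; the sign before the square root [D]
    follows the sign of [t]. *)
Lemma hyperbolic_root (t : R) : 2 < `|t| ->
  exists l : R, 1 < `|l| /\ t = l + l^-1.
Proof.
move=> t2; pose D := Num.sqrt (t ^+ 2 - 4).
have D2 : D ^+ 2 = t ^+ 2 - 4.
  rewrite sqr_sqrtr// subr_ge0 -real_normK ?num_real//; nra.
have D0 : 0 <= D by exact: sqrtr_ge0.
case: (lerP 0 t) => t0.
  rewrite ger0_norm// in t2.
  have l1 : 1 < (t + D) / 2 by lra.
  exists ((t + D) / 2); split; first by rewrite ger0_norm; lra.
  have : t + D != 0 by rewrite gt_eqF//; lra.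
  by move=> h; apply/eqP; rewrite -subr_eq0; apply/eqP; field: D2; rewrite h.
rewrite ltr0_norm// in t2.
have l1 : (t - D) / 2 < -1 by lra.
exists ((t - D) / 2); split; first by rewrite ltr0_norm; lra.
have : t - D != 0 by rewrite lt_eqF//; lra.
by move=> h; apply/eqP; rewrite -subr_eq0; apply/eqP; field: D2; rewrite h.
Qed.

(** The coordinates [w n = p n.+1 - l^-1 * p n] and [z n = p n.+1 - l * p n] diagonalize the limit
    recurrence, with multipliers [l] and [l^-1]. If [z n / w n] tends to 0, the ratio of consecutive
    [p] tends to [l]; if [z] dominates, [p n] is bounded by a multiple of [z n]. *)
Lemma ratio_dichotomy (alpha beta p : nat -> R) (t : R) :
  alpha n @[n --> \oo] --> t -> beta n @[n --> \oo] --> (1 : R) -> 2 < `|t| ->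
  (forall n, p n = 0 -> p n.+1 <> 0) ->
  (forall n, p n.+2 = alpha n * p n.+1 - beta n * p n) ->
  (exists2 l : R, 1 < `|l| & p n.+1 / p n @[n --> \oo] --> l) \/
  abs_summable (fun n => p n ^+ 2).
Proof.
move=> at_ b1 t2 pp0 rec.
have [l [l1 tE]] := hyperbolic_root t2.
have l0 : l != 0 by rewrite -normr_gt0 (lt_trans ltr01).
have li1 : `|l^-1| < 1 by rewrite normfV invf_lt1// normr_gt0.
have ll : l - l^-1 != 0.
  by rewrite subr_eq0; apply/eqP => e; rewrite -e in li1;
    have := lt_trans l1 li1; rewrite ltxx.
have ll1 : l * l - 1 != 0.
  have -> : l * l - 1 = l * (l - l^-1) by field.
  by rewrite mulf_neq0.
pose w n := p n.+1 - l^-1 * p n; pose z n := p n.+1 - l * p n.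
(* Inverting the change of coordinates bounds [|p n|] and [|p n.+1|] by [K * (|w n| + |z n|)]. *)
pose K := (1 + `|l|) / `|l - l^-1|.
have pE n : p n = (w n - z n) / (l - l^-1) by rewrite /w /z; field; rewrite l0 ll1.
have pE1 n : p n.+1 = (l * w n - l^-1 * z n) / (l - l^-1).
  by rewrite /w /z; field; rewrite l0 ll1.
pose d n := K * (`|alpha n - t| + `|beta n - 1|).
have dd : d n @[n --> \oo] --> 0.
  have cvg0 (u : nat -> R) c : u n @[n --> \oo] --> c -> `|u n - c| @[n --> \oo] --> 0.
    move=> uc; apply/norm_cvg0P; rewrite -(subrr c).
    by apply: cvgB => //; exact: cvg_cst.
  rewrite -(mulr0 K); apply: cvgM; first exact: cvg_cst.
  by rewrite -[X in _ --> X](addr0 0); apply: cvgD; exact: cvg0.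
have step n : `|(alpha n - t) * p n.+1 - (beta n - 1) * p n| <= d n * (`|w n| + `|z n|).
  have -> : d n * (`|w n| + `|z n|) = (`|alpha n - t| + `|beta n - 1|) *
      (K * (`|w n| + `|z n|)) by rewrite /d; ring.
  have kw : 0 <= `|w n| + `|z n| by rewrite addr_ge0.
  have pK : `|p n| <= K * (`|w n| + `|z n|).
    rewrite pE normrM normfV /K mulrAC ler_wpM2r ?invr_ge0//.
    rewrite (le_trans (ler_normB _ _))// ler_peMl// lerDl//.
  have p1K : `|p n.+1| <= K * (`|w n| + `|z n|).
    rewrite pE1 normrM normfV /K mulrAC ler_wpM2r ?invr_ge0//.
    rewrite (le_trans (ler_normB _ _))// !normrM.
    have := normr_ge0 (w n); have := normr_ge0 (z n); nra.
  rewrite (le_trans (ler_normB _ _))// !normrM mulrDl lerD// ler_wpM2l//.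
have wz_neq0 n : w n = 0 -> z n <> 0.
  move=> wn zn; have p0 : p n = 0 by rewrite pE wn zn subrr mul0r.
  by apply: (pp0 n p0); rewrite pE1 wn zn !mulr0 subrr mul0r.
have w_step n : `|w n.+1 - l * w n| <= d n * (`|w n| + `|z n|).
  apply: le_trans (step n); rewrite /w rec tE.
  by rewrite le_eqVlt; apply/orP; left; apply/eqP; congr `|_|; field.
have z_step n : `|z n.+1 - l^-1 * z n| <= d n * (`|w n| + `|z n|).
  apply: le_trans (step n); rewrite /z rec tE.
  by rewrite le_eqVlt; apply/orP; left; apply/eqP; congr `|_|; field.
have [[[N _ w0] zw]|[sz [N _ wz]]] := cone_dichotomy l1 dd wz_neq0 w_step z_step.
  left; exists l => //.
  have : (l - l^-1 * (z n / w n)) / (1 - z n / w n) @[n --> \oo]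
      --> (l - l^-1 * 0) / (1 - 0).
    apply: cvgM.
      apply: cvgB; first exact: cvg_cst.
      by apply: cvgM; [exact: cvg_cst|exact: zw].
    apply: cvgV; first by rewrite subr0 oner_neq0.
    by apply: cvgB => //; exact: cvg_cst.
  rewrite mulr0 !subr0 divr1; apply: cvg_trans.
  apply: near_eq_cvg; exists N => // n /= /w0 wn0.
  (* If [z n = w n] then [p n = 0], and both quotients are 0 because the inverse of 0 is 0. *)
  rewrite pE1 pE; have [zwe|zwn] := eqVneq (z n) (w n).
    by rewrite zwe subrr mul0r divff// subrr !invr0 !mulr0.
  have wz0 : w n - z n != 0 by rewrite subr_eq0 eq_sym.
  by field; rewrite wz0 ll1 l0 wn0.
right; apply: (abs_summable_near (C := (2 / `|l - l^-1|) ^+ 2) sz).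
exists N => // n /= /wz h; rewrite !normrX -exprMn lerXn2r ?nnegrE ?mulr_ge0 ?divr_ge0//.
rewrite pE normrM normfV mulrAC ler_wpM2r ?invr_ge0//.
by rewrite (le_trans (ler_normB _ _))//; lra.
Qed.
End HyperbolicRecurrence.

(** * Ratios of Christoffel sums, for square-summable and for growing solutions *)

Section ChristoffelSums.
Context {R : realType}.
Variables (p S : nat -> R) (S0 : R).
Hypotheses (S0_gt0 : 0 < S0) (S_0 : S 0%N = S0)
  (SS : forall n, S n.+1 = S n + p n ^+ 2).

Lemma christoffel_gt0 n : 0 < S n.
Proof.
elim: n => [|n IH]; first by rewrite S_0.
by rewrite SS ltr_wpDr// sqr_ge0.
Qed.

Lemma christoffel_ge n : S0 <= S n.
Proof.
elim: n => [|n IH]; first by rewrite S_0.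
by rewrite SS (le_trans IH)// lerDl sqr_ge0.
Qed.

Let S_neq0 n : S n != 0. Proof. by rewrite gt_eqF// christoffel_gt0. Qed.

(** [S] has summable increments and a limit at least [S0 > 0], so division by it is harmless; the
    products [p n.+1 * p n] are summable because the squares are. *)
Lemma christoffel_bv_summable : abs_summable (fun n => p n ^+ 2) ->
  [/\ S n / S n.+1 @[n --> \oo] --> (1 : R), bv (fun n => S n / S n.+1) &
      bv (fun n => p n.+1 * p n / S n.+1)].
Proof.
move=> sp.
have bS : bv S by apply: eq_summable sp => n; rewrite SS addrC addKr.
have /cvg_ex[/= s Ss] := bv_cvg bS.
have s_gt0 : 0 < s.
  apply: (lt_le_trans S0_gt0); rewrite -(cvg_lim _ Ss)//.
  apply: limr_ge; first by apply/cvg_ex; exists s.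
  by apply: nearW; exact: christoffel_ge.
have s0 : s != 0 by rewrite gt_eqF.
have SsS : S n.+1 @[n --> \oo] --> s by rewrite cvg_shiftS.
split.
- by rewrite -(divff s0); apply: cvgM => //; exact: cvgV.
- by apply: bvM => //; apply: (@bvV _ _ s) => //; exact: bvS.
apply: bvM; last by apply: (@bvV _ _ s) => //; exact: bvS.
apply: abs_summable_bv.
apply: (abs_summable_near (C := 1) (abs_summableD (abs_summableS sp) sp)); near=> n.
rewrite mul1r /= [leRHS]ger0_norm ?addr_ge0 ?sqr_ge0// normrM.
rewrite -(real_normK (num_real (p n))) -(real_normK (num_real (p n.+1))).
have := normr_ge0 (p n); have := normr_ge0 (p n.+1); nra.
Unshelve. all: by end_near. Qed.

(** With [y n = S n.+1 / p n ^+ 2] one has [y n.+1 = 1 + w n * y n], an affine contraction since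
    [w n] tends to [W = l^-1 ^+ 2 < 1]. Hence [y] has bounded variation, and both sequences of the
    conclusion are expressed through [y] and the ratio [t]. The fixed point [Y = 1 + W * Y] gives
    the limit [1 - Y^-1 = W]. *)
Lemma christoffel_bv_growth (l : R) : 1 < `|l| ->
  p n.+1 / p n @[n --> \oo] --> l -> bv (fun n => p n.+1 / p n) ->
  [/\ S n / S n.+1 @[n --> \oo] --> l^-1 ^+ 2, bv (fun n => S n / S n.+1) &
      bv (fun n => p n.+1 * p n / S n.+1)].
Proof.
move=> l1 tl bt; set t := fun n => p n.+1 / p n in tl bt.
have l0 : l != 0 by rewrite -normr_gt0 (lt_trans ltr01).
pose y n := S n.+1 / p n ^+ 2; pose w n := (t n)^-1 ^+ 2.
have bw : bv w.
  by apply: eq_bv (bvM (bvV bt tl l0) (bvV bt tl l0)) => n; rewrite -expr2.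
have wl : w n @[n --> \oo] --> l^-1 ^+ 2.
  by apply: cvgM; exact: cvgV.
have w1 : l^-1 ^+ 2 < 1.
  rewrite -real_normK ?num_real// expr_lt1// normfV invf_lt1//.
  by rewrite (lt_trans ltr01).
have w0 : 0 < l^-1 ^+ 2 by rewrite exprn_even_gt0//= invr_eq0.
set W := l^-1 ^+ 2 in wl w1 w0 *.
pose q := (1 + W) / 2.
have Wq : W < q by rewrite /q; lra.
have q1 : q < 1 by rewrite /q; lra.
have tn1 := cvg_near_norm_gt tl l1.
have [N _ HN] := filterI tn1 (cvgr_lt _ wl _ Wq).
have p0 n : (N <= n)%N -> p n != 0.
  move=> /HN[/= h _]; apply/eqP => pn0.
  by move: h; rewrite /t pn0 invr0 mulr0 normr0 ltNge ler01.
have wq n : (N <= n)%N -> 0 <= w n < q.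
  by move=> /HN[_ /= h]; rewrite h sqr_ge0.
have yS n : (N <= n)%N -> y n.+1 = 1 + w n * y n.
  move=> Nn; have z := p0 n Nn; have z1 := p0 n.+1 (leq_trans Nn (leqnSn n)).
  rewrite /y /w /t (SS n.+1); field; rewrite z z1//.
have y0 n : 0 <= y n.
  by rewrite /y divr_ge0// ?sqr_ge0// ltW// christoffel_gt0.
have yB n : (N <= n)%N -> y n <= y N + (1 - q)^-1.
  elim: n => [|n IH]; first by rewrite leqn0 => /eqP ->;
    rewrite lerDl invr_ge0 subr_ge0 ltW.
  rewrite leq_eqVlt => /predU1P[<-|]; first by rewrite lerDl invr_ge0 subr_ge0 ltW.
  rewrite ltnS => Nn; rewrite yS//.
  have /andP[wn0 wnq] := wq n Nn; have {}IH := IH Nn.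
  have e : (1 - q) * (1 - q)^-1 = 1 by rewrite mulfV// gt_eqF// subr_gt0.
  have i0 : 0 <= (1 - q)^-1 by rewrite invr_ge0 subr_ge0 ltW.
  have := y0 n; have := y0 N; nra.
have y_bv : bv y.
  set M := y N + (1 - q)^-1 in yB.
  apply: (abs_summable_contract q1 (f := fun n => M * (w n.+1 - w n))).
    by apply: (abs_summable_near (C := `|M|) bw); near=> n; rewrite normrM.
  exists N => // n /= Nn; have Nn1 := leq_trans Nn (leqnSn n).
  rewrite !yS// -/(y _).
  (* The next increment of [y] is the present one times [w n.+1 < q], plus the change of [w] times
     the bounded value [y n]. *)
  have -> : 1 + w n.+1 * (1 + w n * y n) - (1 + w n * y n)
      = w n.+1 * (1 + w n * y n - y n) + (w n.+1 - w n) * y n by ring.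
  rewrite (le_trans (ler_normD _ _))// (normrM (w n.+1)).
  rewrite (normrM (_ - _) (y n)) (normrM M) lerD//.
    have /andP[wn0 wnq] := wq n.+1 Nn1.
    by rewrite ler_wpM2r// ger0_norm// ltW.
  rewrite mulrC ler_wpM2r// ger0_norm// (le_trans _ (ler_norm _))//; exact: yB.
have /cvg_ex[/= Y yY] := bv_cvg y_bv.
have YE : Y = 1 + W * Y.
  have y1 : y n.+1 @[n --> \oo] --> Y by rewrite cvg_shiftS.
  have y2 : y n.+1 @[n --> \oo] --> 1 + W * Y.
    have : 1 + w n * y n @[n --> \oo] --> 1 + W * Y.
      by apply: cvgD; [exact: cvg_cst|exact: cvgM].
    apply: cvg_trans; apply: near_eq_cvg; exists N => // n /= Nn.
    by rewrite yS.
  by rewrite -[LHS](cvg_lim _ y1)// (cvg_lim _ y2).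
have Y0 : Y != 0.
  by apply/eqP => Y0; move: YE; rewrite Y0 mulr0 addr0 => /eqP; rewrite eq_sym oner_eq0.
have WE : W = 1 - Y^-1.
  by apply: (mulIf Y0); rewrite mulrBl mul1r mulVf// -[LHS](addKr 1) -YE addrC.
(* The inverse of [y n] is [p n ^+ 2 / S n.+1], also where [p n = 0], so the two formulas hold for
   every [n]. *)
have ratioE : (fun n => S n / S n.+1) = (fun n => 1 - (y n)^-1).
  apply/funext => n; rewrite /y invf_div.
  by rewrite -{1}(addrK (p n ^+ 2) (S n)) -SS mulrBl divff.
have cE : (fun n => p n.+1 * p n / S n.+1) = (fun n => t n * (y n)^-1).
  apply/funext => n; rewrite /y /t invf_div.
  have [->|pn0] := eqVneq (p n) 0; first by rewrite invr0 !mulr0 !mul0r.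
  by have := S_neq0 n.+1 => h; field; rewrite h.
rewrite ratioE cE; split.
- by rewrite WE; apply: cvgB; [exact: cvg_cst|exact: cvgV].
- by apply: bvB; [exact: bv_cst|exact: (bvV y_bv yY)].
- by apply: bvM => //; exact: (bvV y_bv yY).
Unshelve. all: by end_near. Qed.

End ChristoffelSums.

(** * Bounded variation of the ratios of a growing solution, and of the data of one point mass *)

Section RatioBV.
Context {R : realType}.

(** The ratio satisfies [t n.+1 = alpha n - beta n / t n]. Subtracting two consecutive instances
    multiplies the increment by [beta n / (t n * t n.+1)], which tends to [l^-1 ^+ 2], and adds
    increments of [alpha] and [beta]. *)
Lemma ratio_bv (alpha beta p : nat -> R) (l : R) :
  bv alpha -> bv beta -> beta n @[n --> \oo] --> (1 : R) -> 1 < `|l| ->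
  (forall n, p n.+2 = alpha n * p n.+1 - beta n * p n) ->
  p n.+1 / p n @[n --> \oo] --> l -> bv (fun n => p n.+1 / p n).
Proof.
move=> ba bb b1 l1 rec tl; set t := fun n => p n.+1 / p n in tl *.
have l0 : l != 0 by rewrite -normr_gt0 (lt_trans ltr01).
pose W := `|l^-1 ^+ 2|.
have w1 : W < 1.
  rewrite /W ger0_norm ?sqr_ge0// -real_normK ?num_real// expr_lt1// normfV invf_lt1//.
  by rewrite (lt_trans ltr01).
pose q := (1 + W) / 2.
have Wq : W < q by rewrite /q; lra.
have q1 : q < 1 by rewrite /q; lra.
have tl' : t n.+1 @[n --> \oo] --> l by rewrite cvg_shiftS.
have kl : `|beta n * ((t n)^-1 * (t n.+1)^-1)| @[n --> \oo] --> `|1 * (l^-1 * l^-1)|.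
  by apply: cvg_norm; apply: cvgM => //; apply: cvgM; exact: cvgV.
have Wq' : `|1 * (l^-1 * l^-1)| < q by rewrite mul1r.
have [N _ HN] := filterI (cvg_near_norm_gt tl l1) (cvgr_lt _ kl _ Wq').
have t1 n : (N <= n)%N -> 1 < `|t n| by move=> /HN[].
have t0 n : (N <= n)%N -> t n != 0.
  by move=> /t1 h; rewrite -normr_gt0 (lt_trans ltr01).
have p0 n : (N <= n)%N -> p n != 0.
  by move=> /t0; apply: contra_neq => h; rewrite /t h invr0 mulr0.
have tS n : (N <= n)%N -> t n.+1 = alpha n - beta n / t n.
  move=> Nn; rewrite /t rec; field.
  by rewrite !p0// (leq_trans Nn).
apply: (abs_summable_contract q1 (abs_summableD (abs_summable_norm ba) (abs_summable_norm bb))).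
exists N => // n /= Nn; have Nn1 := leq_trans Nn (leqnSn n).
have -> : t n.+2 - t n.+1 = beta n * ((t n)^-1 * (t n.+1)^-1) * (t n.+1 - t n)
   + ((alpha n.+1 - alpha n) - (beta n.+1 - beta n) / t n.+1).
  rewrite (tS n.+1)// {2}(tS n)//; have := t0 n Nn; have := t0 n.+1 Nn1 => h h'.
  by field; rewrite h h'.
rewrite (le_trans (ler_normD _ _))// normrM lerD//.
  by rewrite ler_wpM2r// ltW//; have [] := HN n Nn.
rewrite [leRHS]ger0_norm ?addr_ge0// (le_trans (ler_normB _ _))// lerD2l.
rewrite normrM normfV ler_piMr// invf_le1 ?ltW ?t1//.
by rewrite (lt_trans ltr01) ?t1.
Qed.

(** Solved for [p n.+2], the recurrence has limit coefficients [t = (x - B) / A] and 1; the limit is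
    hyperbolic, [|t| > 2], because [x] lies outside the interval. *)
Lemma point_mass_ratio_bv (a b p S : nat -> R) (A B x S0 : R) :
  0 < S0 -> S 0%N = S0 -> (forall n, S n.+1 = S n + p n ^+ 2) ->
  (forall n, 0 < a n.+1) -> 0 < A ->
  a n @[n --> \oo] --> A -> b n @[n --> \oo] --> B -> bv a -> bv b ->
  2 * A < `|x - B| -> p 0%N != 0 ->
  x * p 0%N = a 1%N * p 1%N + b 1%N * p 0%N ->
  (forall n, x * p n.+1 = a n.+2 * p n.+2 + b n.+2 * p n.+1 + a n.+1 * p n) ->
  exists s : R, [/\ 0 < s, S n / S n.+1 @[n --> \oo] --> s,
    bv (fun n => S n / S n.+1) & bv (fun n => p n.+1 * p n / S n.+1)].
Proof.
move=> S0_gt0 S_0 SS a0 A0 aA bB ba bb xB p00 rec0 rec.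
pose alpha n := (x - b n.+2) / a n.+2; pose beta n := a n.+1 / a n.+2.
have An0 : A != 0 by rewrite gt_eqF.
have aA1 : a n.+1 @[n --> \oo] --> A by rewrite cvg_shiftS.
have aA2 : a n.+2 @[n --> \oo] --> A by rewrite (cvg_shiftS (fun n => a n.+1)).
have bB2 : b n.+2 @[n --> \oo] --> B.
  by rewrite (cvg_shiftS (fun n => b n.+1)) cvg_shiftS.
have alphaE : alpha n @[n --> \oo] --> (x - B) / A.
  by apply: cvgM; [apply: cvgB => //; exact: cvg_cst|exact: cvgV].
have betaE : beta n @[n --> \oo] --> (1 : R).
  by rewrite -(divff An0); apply: cvgM => //; exact: cvgV.
have bva2 : bv (fun n => (a n.+2)^-1) by exact: (bvV (bvS (bvS ba)) aA2 An0).
have balpha : bv alpha by apply: bvM => //; exact: (bvB (bv_cst x) (bvS (bvS bb))).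
have bbeta : bv beta by exact: (bvM (bvS ba) bva2).
(* Two consecutive zeros would propagate down to [p 0%N], as [a n.+1] is nonzero. *)
have pp0 n : p n = 0 -> p n.+1 <> 0.
  elim: n => [/eqP|n IH pn1 pn2]; first by rewrite (negPf p00).
  have := rec n; rewrite pn1 pn2 !mulr0 !add0r => /esym/eqP.
  by rewrite mulf_eq0 gt_eqF//= => /eqP /IH; apply.
have rec' n : p n.+2 = alpha n * p n.+1 - beta n * p n.
  have an0 : a n.+2 != 0 by rewrite gt_eqF.
  apply: (mulfI an0); rewrite /alpha /beta mulrBr !mulrA.
  rewrite (_ : a n.+2 * _ = a n.+2 * p n.+2)//.
  have := rec n; rewrite mulrAC.
  by move=> h; field: h.
have t2 : 2 < `|(x - B) / A|.
  by rewrite normrM normfV (gtr0_norm A0) ltr_pdivlMr.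
have [[l l1 tl]|sp] := ratio_dichotomy alphaE betaE t2 pp0 rec'.
  have bt := ratio_bv balpha bbeta betaE l1 rec' tl.
  have [h1 h2 h3] := christoffel_bv_growth S0_gt0 S_0 SS l1 tl bt.
  exists (l^-1 ^+ 2); split => //.
  by rewrite exprn_even_gt0//= invr_eq0 -normr_gt0 (lt_trans ltr01).
have [h1 h2 h3] := christoffel_bv_summable S0_gt0 S_0 SS sp.
by exists 1; split.
Qed.

End RatioBV.

(** * Orthonormal systems *)

Section OrthonormalSystems.
Context {R : realType}.
Implicit Types (L : {scalar {poly R}}) (p : nat -> {poly R}) (f : {poly R}).

(** The algebra is done for a linear functional [L] on polynomials, to be integration against a
    measure; [L (f * h)] then is the inner product. *)
Definition posdef L := forall f, f != 0 -> 0 < L (f * f).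

Definition orthonormal L p :=
  [/\ forall n, size (p n) = n.+1,
      forall n, 0 < lead_coef (p n) &
      forall i j, L (p i * p j) = (i == j)%:R].

(** For [p = orthonormal_poly mu] this is convertible with [recurrence_coefficients mu a b]. *)
Definition three_term p (a b : nat -> R) :=
  (forall n, (1 <= n)%N -> 0 < a n) /\
  (forall n, 'X * p n = a n.+1 *: p n.+1 + b n.+1 *: p n
                        + (if n is m.+1 then a n *: p m else 0)).

Section System.
Variables (L : {scalar {poly R}}) (p : nat -> {poly R}).
Hypothesis onp : orthonormal L p.

Lemma orthonormal_sumr n (c : nat -> R) k :
  L ((\sum_(i < n) c i *: p i) * p k) = if (k < n)%N then c k else 0.
Proof.
have [_ _ ortho] := onp.
rewrite mulr_suml linear_sum /=.
under eq_bigr => i _ do rewrite -scalerAl linearZ /= ortho.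
case: ltnP => kn.
  rewrite (bigD1 (Ordinal kn)) //= eqxx mulr1 big1 ?addr0// => i ik.
  by rewrite -val_eqE /= in ik; rewrite (negPf ik) mulr0.
rewrite big1 // => i _.
by rewrite (ltn_eqF (leq_trans (ltn_ord i) kn)) mulr0.
Qed.

Lemma orthonormal_span n f : (size f <= n)%N ->
  exists c : nat -> R, f = \sum_(i < n) c i *: p i.
Proof.
have [sz lc _] := onp.
elim: n f => [|n IH] f fn.
  exists (fun=> 0); rewrite big_ord0; apply/eqP.
  by rewrite -size_poly_eq0 -leqn0.
pose r := f`_n / lead_coef (p n).
have lcE : lead_coef (p n) = (p n)`_n by rewrite lead_coefE sz.
have : (size (f - r *: p n)%R <= n)%N.
  apply/leq_sizeP => j; rewrite leq_eqVlt => /predU1P[<-|nj].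
    by rewrite coefB coefZ /r -lcE divfK ?subrr // gt_eqF.
  rewrite coefB coefZ [f`_j]nth_default ?(leq_trans fn)//.
  by rewrite nth_default ?sz// mulr0 subr0.
move=> /IH[c cE]; exists (fun i => if i == n then r else c i).
rewrite big_ord_recr /= eqxx.
under eq_bigr => i _ do rewrite (ltn_eqF (ltn_ord i)).
by rewrite -cE subrK.
Qed.

Lemma orthonormal_expand n f : (size f <= n)%N ->
  f = \sum_(i < n) L (f * p i) *: p i.
Proof.
move=> /orthonormal_span[c fE]; rewrite {1}fE; apply: eq_bigr => i _.
by rewrite fE orthonormal_sumr ltn_ord.
Qed.

Lemma orthonormal_perp n f : (size f <= n)%N -> L (f * p n) = 0.
Proof. by move=> /orthonormal_span[c ->]; rewrite orthonormal_sumr ltnn. Qed.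

Lemma orthonormal_parseval n (c : nat -> R) :
  L ((\sum_(i < n) c i *: p i) * (\sum_(i < n) c i *: p i))
  = \sum_(i < n) c i ^+ 2.
Proof.
set s := \sum_(i < n) _.
rewrite {2}/s mulr_sumr linear_sum /=; apply: eq_bigr => i _.
by rewrite -scalerAr linearZ /= orthonormal_sumr ltn_ord expr2.
Qed.

Lemma orthonormal_posdef : posdef L.
Proof.
move=> f f0; have [c fE] := orthonormal_span (leqnn (size f)).
rewrite {1 2}fE orthonormal_parseval lt_neqAle sumr_ge0 ?andbT; last first.
  by move=> i _; exact: sqr_ge0.
apply: contra_neq f0 => /esym /eqP; rewrite psumr_eq0; last first.
  by move=> i _; exact: sqr_ge0.
move=> /allP c0; rewrite fE big1// => i _.
by have := c0 i (mem_index_enum _); rewrite sqrf_eq0 => /eqP ->; rewrite scale0r.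
Qed.

Lemma orthonormal_size_mulX n : size ('X * p n) = n.+2.
Proof.
have [sz _ _] := onp.
by rewrite mulrC size_mulX ?sz// -size_poly_eq0 sz.
Qed.

(** For [i.+1 < n] the polynomial ['X * p i] has degree below [n], so ['X * p n] has no component
    along [p i]. Comparing leading coefficients gives the positivity of [a]. The [n.-1] produces the
    indexing from 1. *)
Lemma orthonormal_three_term :
  three_term p (fun n => L ('X * p n.-1 * p n)) (fun n => L ('X * p n.-1 * p n.-1)).
Proof.
have [sz lc _] := onp.
have rec n : 'X * p n = L ('X * p n * p n.+1) *: p n.+1
    + L ('X * p n * p n) *: p n
    + (if n is m.+1 then L ('X * p m * p n) *: p m else 0).
  rewrite {1}(@orthonormal_expand n.+2 ('X * p n)) ?orthonormal_size_mulX//.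
  rewrite !big_ord_recr /= addrC [X in _ + X]addrC addrA; congr (_ + _).
  case: n => [|n]; first by rewrite big_ord0.
  rewrite big_ord_recr /= big1 ?add0r => [|i _].
    by rewrite mulrAC.
  rewrite mulrAC orthonormal_perp ?scale0r//.
  by rewrite orthonormal_size_mulX ltnS.
split=> [|n]; last by have := rec n; case: n.
move=> -[//|n] _ /=.
have := rec n; set tail := (X in _ + X).
have ztail : tail`_n.+1 = 0.
  rewrite /tail; case: (n) => [|m]; first by rewrite coef0.
  by rewrite coefZ nth_default ?mulr0// sz.
move=> /(congr1 (fun q : {poly R} => q`_n.+1)).
have z : (p n)`_n.+1 = 0 by rewrite nth_default ?sz.
rewrite coefXM /= !coefD !coefZ z ztail mulr0 !addr0.
have := lc n; rewrite lead_coefE sz /= => + e; rewrite e.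
by rewrite pmulr_lgt0 //; have := lc n.+1; rewrite lead_coefE sz.
Qed.

Lemma three_term_coefE (a b : nat -> R) n : three_term p a b ->
  a n.+1 = L ('X * p n * p n.+1) /\ b n.+1 = L ('X * p n * p n).
Proof.
have [_ _ ortho] := onp.
move=> [_ ->]; rewrite !mulrDl !linearD /= -!scalerAl !linearZ /= !ortho.
rewrite !eqxx (ltn_eqF (ltnSn n)) (gtn_eqF (ltnSn n)) /=.
case: n => [|n]; first by rewrite !mul0r linear0; split; ring.
rewrite -!scalerAl !linearZ /= !ortho (ltn_eqF (ltnSn n)).
by rewrite (ltn_eqF (leqnSn n.+1)) /=; split; ring.
Qed.

End System.

(** [p n] is orthogonal to the lower [q i], hence a multiple of [q n]; norm 1 and positive leading
    coefficients force the factor 1. *)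
Lemma orthonormal_unique L p q : orthonormal L p -> orthonormal L q -> p =1 q.
Proof.
move=> onp onq n; have [szp lcp orp] := onp; have [szq lcq orq] := onq.
have pE : p n = L (p n * q n) *: q n.
  rewrite {1}(orthonormal_expand onq (_ : size (p n) <= n.+1)%N) ?szp//.
  rewrite big_ord_recr /= big1 ?add0r// => i _.
  by rewrite mulrC (orthonormal_perp onp) ?scale0r// szq.
set c := L _ in pE.
have c_gt0 : 0 < c.
  have := lcp n; rewrite pE lead_coefZ => h.
  by rewrite -(pmulr_lgt0 _ (lcq n)).
have /eqP := orp n n; rewrite pE -scalerAl -scalerAr !linearZ /= orq eqxx /= mulr1.
rewrite -expr2 sqrf_eq1 => /orP[/eqP ->|/eqP c1]; first by rewrite scale1r.
by move: c_gt0; rewrite c1 oppr_gt0 ltr10.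
Qed.

Section GramSchmidt.
Variable (L : {scalar {poly R}}).

(** Gram-Schmidt is restated for a functional so that it also serves for the restriction of [mu] to
    a set. *)
Definition gs_normalize f := (Num.sqrt (L (f * f)))^-1 *: f.

Fixpoint gs_seq n : seq {poly R} :=
  if n is m.+1 then
    let s := gs_seq m in
    rcons s (gs_normalize ('X^m - \sum_(q <- s) L (q * 'X^m) *: q))
  else [::].

Definition gs_poly n := (gs_seq n.+1)`_n.

Lemma orthonormal_poly_gs (mu : {measure set (measurableTypeR R) -> \bar R}) :
  (forall f g, poly_inner mu f g = L (f * g)) -> orthonormal_poly mu =1 gs_poly.
Proof.
move=> innerE n; rewrite /orthonormal_poly /gs_poly; congr (_`_n).
elim: n.+1 => // m IH; rewrite [LHS]/= [RHS]/= IH /poly_normalize innerE.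
by congr (rcons _ (gs_normalize (_ - _))); under eq_bigr do rewrite innerE.
Qed.

Hypothesis (L_gt0 : posdef L).

Lemma gs_seq_mkseq n :
  gs_seq n = mkseq gs_poly n.
Proof.
have sz m : size (gs_seq m) = m.
  by elim: m => //= m IH; rewrite size_rcons IH.
apply: (@eq_from_nth _ 0) => [|i]; rewrite ?size_mkseq sz // => lti.
rewrite nth_mkseq// /gs_poly.
elim: n lti => // n IH; rewrite ltnS leq_eqVlt => /predU1P[->//|lti].
by rewrite [LHS]nth_rcons sz lti IH.
Qed.

Lemma gs_polyE n : gs_poly n = gs_normalize
  ('X^n - \sum_(i < n) L (gs_poly i * 'X^n) *: gs_poly i).
Proof.
rewrite [LHS](_ : _ = nth 0 (gs_seq n.+1) n)//= nth_rcons.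
have -> : size (gs_seq n) = n by rewrite gs_seq_mkseq size_mkseq.
rewrite ltnn eqxx gs_seq_mkseq /mkseq big_map.
rewrite -(big_mkord xpredT (fun i => L (gs_poly i * 'X^n) *: gs_poly i)).
by rewrite /index_iota subn0.
Qed.

Lemma orthonormal_gs_poly : orthonormal L gs_poly.
Proof.
set o := gs_poly.
suff H n : [/\ size (o n) = n.+1, 0 < lead_coef (o n), L (o n * o n) = 1 &
    forall j, (j < n)%N -> L (o n * o j) = 0].
  split=> [n|n|i j]; [by have [] := H n|by have [] := H n|].
  case: (ltngtP i j) => [ij|ji|<-]; last by have [] := H i.
    by rewrite mulrC; have [_ _ _ ->] := H j.
  by have [_ _ _ ->] := H i.
elim/ltn_ind: n => n IH.
set s := \sum_(i < n) L (o i * 'X^n) *: o i.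
have szs : (size s <= n)%N.
  apply: (leq_trans (size_sum _ _ _)); apply/bigmax_leqP => i _.
  apply: (leq_trans (size_scale_leq _ _)).
  by have [-> _ _ _] := IH i (ltn_ord i).
have szd : size ('X^n - s) = n.+1.
  by rewrite size_polyDl size_polyXn// size_polyN ltnS.
have d0 : 'X^n - s != 0 by rewrite -size_poly_eq0 szd.
have oE : o n = (Num.sqrt (L (('X^n - s) * ('X^n - s))))^-1 *: ('X^n - s).
  by rewrite /o gs_polyE.
set h := L _ in oE.
have h_gt0 : 0 < h by exact: L_gt0.
have k_gt0 : 0 < (Num.sqrt h)^-1 by rewrite invr_gt0 sqrtr_gt0.
rewrite oE; split.
- by rewrite size_scale ?gt_eqF.
- rewrite lead_coefZ mulr_gt0// lead_coefDl ?lead_coefXn//.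
  by rewrite size_polyN size_polyXn ltnS.
- rewrite -scalerAl -scalerAr !linearZ /= -/h mulrA -invfM -expr2.
  by rewrite sqr_sqrtr ?ltW// mulVf// gt_eqF.
move=> j ltj; rewrite -scalerAl linearZ /= mulrBl linearB /=.
have -> : L (s * o j) = L (o j * 'X^n).
  rewrite mulr_suml linear_sum /= (bigD1 (Ordinal ltj)) //= big1.
    rewrite -scalerAl linearZ /=; have [_ _ -> _] := IH j ltj.
    by rewrite mulr1 addr0.
  move=> i; rewrite -val_eqE /= => ij; rewrite -scalerAl linearZ /=.
  case: (ltngtP i j) ij => // ij _.
    by rewrite (mulrC (o i) (o j)); have [_ _ _ ->] := IH j ltj; rewrite ?mulr0.
  by have [_ _ _ ->] := IH i (ltn_ord i); rewrite ?mulr0.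
by rewrite (mulrC 'X^n) subrr mulr0.
Qed.

End GramSchmidt.

End OrthonormalSystems.

(** * Adding a point mass *)

Section AddMass.
Context {R : realType}.

Definition add_mass (L : {poly R} -> R) (g x : R) (f : {poly R}) : R :=
  L f + g * f.[x].

Lemma add_mass_is_scalar (L : {scalar {poly R}}) (g x : R) :
  scalar (add_mass L g x).
Proof.
by move=> k f h; rewrite /add_mass linearP /= hornerD hornerZ; ring.
Qed.

HB.instance Definition _ (L : {scalar {poly R}}) (g x : R) :=
  GRing.isLinear.Build _ _ _ _ (add_mass L g x) (add_mass_is_scalar L g x).

Variables (L : {scalar {poly R}}) (p : nat -> {poly R}) (a b : nat -> R) (g x : R).
Hypotheses (onp : orthonormal L p) (rec : three_term p a b) (g_gt0 : 0 < g).

Let L' : {scalar {poly R}} := add_mass L g x.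
Let v n := (p n).[x].

(** Starting at [g^-1] absorbs the factor [1 + g * K_n(x, x)] of the classical formulas, [K_n] being
    the Christoffel-Darboux kernel; it equals [g * christoffel_sum n]. *)
Definition christoffel_sum n := g^-1 + \sum_(j < n) v j ^+ 2.
Local Notation S := christoffel_sum.

Definition christoffel_kernel n := \sum_(j < n) v j *: p j.
Local Notation kern := christoffel_kernel.

(* Uvarov's formula: unnormalized orthogonal polynomials of the new measure. *)
Definition mass_poly n := p n - (v n / S n) *: kern n.
Local Notation q := mass_poly.

Let S0_gt0 : 0 < g^-1. Proof. by rewrite invr_gt0. Qed.
Let S_0 : S 0%N = g^-1. Proof. by rewrite /S big_ord0 addr0. Qed.
Let SS n : S n.+1 = S n + v n ^+ 2.
Proof. by rewrite /S big_ord_recr /= addrA. Qed.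
Let S_gt0 n : 0 < S n. Proof. exact: christoffel_gt0 S0_gt0 S_0 SS n. Qed.
Let S_neq0 n : S n != 0. Proof. by rewrite gt_eqF. Qed.
Let g_neq0 : g != 0. Proof. by rewrite gt_eqF. Qed.

Let szp n : size (p n) = n.+1. Proof. by case: onp. Qed.

Lemma size_christoffel_kernel n : (size (kern n) <= n)%N.
Proof.
apply: (leq_trans (size_sum _ _ _)); apply/bigmax_leqP => i _.
by rewrite (leq_trans (size_scale_leq _ _))// szp.
Qed.

Lemma mass_poly_eval n : (q n).[x] = v n / (g * S n).
Proof.
have kernE : (kern n).[x] = S n - g^-1.
  rewrite horner_sum /S addrC addKr; apply: eq_bigr => j _.
  by rewrite hornerZ expr2.
rewrite hornerD hornerN hornerZ kernE -/(v n).
by field; rewrite S_neq0 g_neq0.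
Qed.

Let size_lower n : (size ((v n / S n) *: kern n) <= n)%N.
Proof. exact: leq_trans (size_scale_leq _ _) (size_christoffel_kernel n). Qed.

Lemma size_mass_poly n : size (q n) = n.+1.
Proof. by rewrite size_polyDl szp// size_polyN ltnS. Qed.

Lemma lead_coef_mass_poly n : lead_coef (q n) = lead_coef (p n).
Proof. by rewrite lead_coefDl// size_polyN szp ltnS. Qed.

(** For [i < n], [L] contributes [- v i * v n / S n] and the mass contributes the opposite. For
    [i = n] the sum is [1 + v n ^+ 2 / S n]. *)
Lemma add_mass_mass_poly i n : (i <= n)%N ->
  L' (p i * q n) = if (i < n)%N then 0 else S n.+1 / S n.
Proof.
move=> lein; rewrite {1}/L' /= /add_mass hornerM mass_poly_eval -/(v i).
have -> : L (p i * q n) = (i == n)%:R - (v n / S n) * (if (i < n)%N then v i else 0).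
  have [_ _ ortho] := onp.
  rewrite mulrBr linearB /= ortho -scalerAr linearZ /= [p i * _]mulrC.
  by rewrite (orthonormal_sumr onp).
case: ltngtP lein => // [ltin|<-] _.
  by rewrite /=; field; rewrite S_neq0 g_neq0.
by rewrite SS /=; field; rewrite S_neq0 g_neq0.
Qed.

Lemma add_mass_perp (f : {poly R}) n : (size f <= n)%N -> L' (f * q n) = 0.
Proof.
move=> /(orthonormal_span onp)[c ->]; rewrite mulr_suml linear_sum /=.
apply: big1 => i _; rewrite -scalerAl linearZ /=.
by rewrite (add_mass_mass_poly (ltnW (ltn_ord i))) ltn_ord mulr0.
Qed.

Lemma add_mass_norm n : L' (q n * q n) = S n.+1 / S n.
Proof.
rewrite {1}/q mulrBl linearB /= add_mass_mass_poly// ltnn.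
by rewrite add_mass_perp// subr0.
Qed.

Definition mass_orthonormal n := Num.sqrt (S n / S n.+1) *: q n.
Local Notation p' := mass_orthonormal.

Let s n := Num.sqrt (S n / S n.+1).
Let s_gt0 n : 0 < s n. Proof. by rewrite sqrtr_gt0 divr_gt0. Qed.
Let s_neq0 n : s n != 0. Proof. by rewrite gt_eqF. Qed.
Let sqr_s n : s n ^+ 2 = S n / S n.+1.
Proof. by rewrite sqr_sqrtr// divr_ge0 ?ltW. Qed.

Lemma orthonormal_mass : orthonormal L' p'.
Proof.
have [_ lcp _] := onp.
have perp i j : (i < j)%N -> L' (p' i * p' j) = 0.
  move=> ij; rewrite -scalerAl -scalerAr !linearZ /=.
  by rewrite add_mass_perp ?mulr0// size_mass_poly.
split=> [n|n|i j].
- by rewrite size_scale ?size_mass_poly// s_neq0.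
- by rewrite lead_coefZ lead_coef_mass_poly mulr_gt0 ?s_gt0.
case: (ltngtP i j) => [/perp//|/perp|<-]; first by rewrite mulrC.
rewrite -scalerAl -scalerAr !linearZ /= add_mass_norm mulrA -expr2 sqr_s.
by field; rewrite !S_neq0.
Qed.

(** The increments of this sequence are the changes of the coefficients [b]. *)
Definition mass_shift n := a n.+1 * v n.+1 * v n / S n.+1.
Local Notation c := mass_shift.

(** Only the two leading components are needed: [r] has degree below [n] and is orthogonal to [q n]
    and [q n.+1] for the new functional. *)
Lemma mulX_mass_poly n : exists2 r : {poly R}, (size r <= n)%N &
  'X * q n = a n.+1 *: p n.+1
     + (b n.+1 - (if n is m.+1 then c m else 0)) *: p n + r.
Proof.
have [_ recE] := rec.
rewrite mulrBr recE; case: n => [|n].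
  exists 0; first by rewrite size_poly0.
  by rewrite /kern big_ord0 scaler0 mulr0 !addr0 !subr0.
exists (a n.+1 *: p n - (v n.+1 / S n.+1) *: ('X * kern n
    + v n *: (b n.+1 *: p n + (if n is m.+1 then a n *: p m else 0)))).
  have szZ k (f : {poly R}) m : (size f <= m)%N -> (size (k *: f) <= m)%N.
    exact: leq_trans (size_scale_leq _ _).
  have szD (f h : {poly R}) m : (size f <= m)%N -> (size h <= m)%N ->
      (size (f + h)%R <= m)%N.
    by move=> fm hm; rewrite (leq_trans (size_polyD _ _))// geq_max fm.
  apply: (szD); first by rewrite szZ// szp.
  rewrite size_polyN; apply: (szZ); apply: (szD).
    rewrite mulrC; have [->|k0] := eqVneq (kern n) 0; first by rewrite mul0r size_poly0.
    by rewrite size_mulX// ltnS size_christoffel_kernel.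
  apply: (szZ); apply: (szD); first by rewrite szZ// szp.
  by case: (n) => [|m]; rewrite ?size_poly0// szZ// szp.
(* The top term [v n *: p n] of the kernel, multiplied by ['X], reaches [p n.+1]; this is the source
   of [c n]. *)
rewrite /kern big_ord_recr /= -/(kern n) -scalerAr mulrDr -scalerAr recE.
set T := (if n is m.+1 then _ else _).
have -> : c n = v n.+1 / S n.+1 * v n * a n.+1 by rewrite /c; ring.
rewrite !scalerDr !scalerA scalerBl; ring.
Qed.

Lemma mulX_mass_orthonormal m n :
  'X * p' m * p' n = (s m * s n) *: ('X * q m * q n).
Proof. by rewrite /mass_orthonormal -/(s m) -/(s n) -!mul_polyC polyCM; ring. Qed.

Let L'_comb (k l : R) (f1 f2 r h : {poly R}) :
  L' ((k *: f1 + l *: f2 + r) * h) = k * L' (f1 * h) + l * L' (f2 * h) + L' (r * h).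
Proof. by rewrite !mulrDl -!scalerAl !linearD !linearZ. Qed.

(** In terms of [S], the square of the new coefficient is
    [a n.+1 ^+ 2 * S n * S n.+2 / S n.+1 ^+ 2]. *)
Lemma mass_coef_a n : L' ('X * p' n * p' n.+1) = a n.+1 * (s n / s n.+1).
Proof.
rewrite mulX_mass_orthonormal scalarZ.
have -> : L' ('X * q n * q n.+1) = a n.+1 * (S n.+2 / S n.+1).
  have [r szr ->] := mulX_mass_poly n.
  rewrite L'_comb.
  rewrite !add_mass_mass_poly// ltnn ltnSn !mulr0 add_mass_perp ?addr0//.
  exact: leq_trans szr _.
have -> : S n.+2 / S n.+1 = (s n.+1 ^+ 2)^-1 by rewrite sqr_s invf_div.
by field.
Qed.

Lemma mass_coef_b n : L' ('X * p' n * p' n) =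
  b n.+1 - (if n is m.+1 then c m else 0) + c n.
Proof.
rewrite mulX_mass_orthonormal scalarZ -expr2 sqr_s.
set B := b n.+1 - _.
have -> : L' ('X * q n * q n) = a n.+1 * (v n.+1 * v n / S n) + B * (S n.+1 / S n).
  have [r szr ->] := mulX_mass_poly n.
  rewrite L'_comb.
  rewrite (add_mass_mass_poly (leqnn n)) ltnn (add_mass_perp szr) addr0.
  (* [p n.+1] is orthogonal to [q n] for [L], so only the point mass contributes to this product. *)
  congr (_ * _ + _); rewrite /L' /= /add_mass (mulrC (p n.+1)).
  rewrite (orthonormal_perp onp) ?size_mass_poly// add0r hornerM mass_poly_eval.
  by rewrite -/(v n.+1); field; rewrite S_neq0 g_neq0.
by rewrite /c; field; rewrite !S_neq0.
Qed.

(** The factor [s n / s n.+1] tends to 1 because [s n ^+ 2] has the positive limit [t]. The shift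
    [c] has bounded variation, hence a limit [C], which cancels in its increments. *)
Lemma add_mass_preserves (A B : R) : 0 < A ->
  a n @[n --> \oo] --> A -> b n @[n --> \oo] --> B -> bv a -> bv b ->
  2 * A < `|x - B| ->
  exists p' a' b', [/\ orthonormal L' p', three_term p' a' b',
    a' n @[n --> \oo] --> A /\ b' n @[n --> \oo] --> B & bv a' /\ bv b'].
Proof.
move=> A0 aA bB ba bb xB.
have [a0 recE] := rec.
have recx n := congr1 (fun f : {poly R} => f.[x]) (recE n).
have v0 : v 0%N != 0.
  have := szp 0; move=> /eqP/size_poly1P[k k0 pk].
  by rewrite /v pk hornerC.
have [t [t0 St bS bc]] : exists t : R, [/\ 0 < t, S n / S n.+1 @[n --> \oo] --> t,
    bv (fun n => S n / S n.+1) & bv (fun n => v n.+1 * v n / S n.+1)].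
  apply: (@point_mass_ratio_bv _ a b v S A B x g^-1) => //.
  - by move=> n; exact: a0.
  - have := recx 0%N; rewrite /= !hornerD !hornerZ hornerM hornerX horner0.
    by rewrite addr0.
  - move=> n; have := recx n.+1; rewrite /= !hornerD !hornerZ hornerM hornerX.
    by [].
have bcc : bv c.
  apply: eq_bv (bvM (bvS ba) bc) => n; rewrite /c !mulrA//.
have /cvg_ex[/= C cC] := bv_cvg bcc.
exists p', (fun n => L' ('X * p' n.-1 * p' n)), (fun n => L' ('X * p' n.-1 * p' n.-1)).
have aE n : L' ('X * p' n.+1.-1 * p' n.+1) = a n.+1 * (s n / s n.+1).
  exact: mass_coef_a.
(* From index 2 on both shift terms are present, so the case distinction of [mass_coef_b]
   disappears. *)
have bE n : L' ('X * p' n.+2.-1 * p' n.+2.-1) = b n.+2 - c n + c n.+1.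
  exact: mass_coef_b.
have sT : s n @[n --> \oo] --> Num.sqrt t.
  by apply: continuous_cvg => //; exact: sqrt_continuous.
have sqt : Num.sqrt t != 0 by rewrite gt_eqF// sqrtr_gt0.
have bs : bv s by exact: bv_sqrt bS St t0.
have sT1 : s n.+1 @[n --> \oo] --> Num.sqrt t by rewrite cvg_shiftS.
have aT : a n.+1 * (s n / s n.+1) @[n --> \oo] --> A.
  have -> : A = A * (Num.sqrt t / Num.sqrt t) by rewrite divff// mulr1.
  apply: cvgM; first by rewrite cvg_shiftS.
  by apply: cvgM => //; exact: cvgV.
have bT : b n.+2 - c n + c n.+1 @[n --> \oo] --> B.
  have -> : B = B - C + C by rewrite subrK.
  apply: cvgD; last by rewrite cvg_shiftS.
  by apply: cvgB => //; rewrite (cvg_shiftS (fun n => b n.+1)) cvg_shiftS.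
split; first exact: orthonormal_mass.
- exact: (orthonormal_three_term orthonormal_mass).
- split.
    rewrite -cvg_shiftS.
    by apply: cvg_trans aT; apply: near_eq_cvg; near=> n; rewrite -aE.
  rewrite -cvg_shiftS -(cvg_shiftS (fun n => L' ('X * p' n * p' n))).
  by apply: cvg_trans bT; apply: near_eq_cvg; near=> n; rewrite -bE.
split.
  apply: bvSr; apply: (eq_bv aE); apply: bvM; first exact: bvS.
  by apply: bvM => //; exact: (bvV (bvS bs) sT1).
do 2 apply: bvSr; apply: (eq_bv bE); apply: bvD; last exact: bvS.
by apply: bvB => //; exact: (bvS (bvS bb)).
Unshelve. all: by end_near. Qed.

End AddMass.

(** * Norm estimates for the Jacobi operator *)

Section Jacobi.
Context {R : realType}.

(** The default 0 corresponds to $p_{-1} = 0$. *)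
Definition prev_coef (c : nat -> R) n := if n is m.+1 then c m else 0.

(** Schur test for a tridiagonal matrix: Cauchy-Schwarz with weights [A], [E], [A] bounds each
    [d n ^+ 2], and the shifted sums of squares are at most the unshifted one. The range [M.+1]
    leaves room for the upward shift. *)
Lemma band_sum_le (c d : nat -> R) (A E : R) M : 0 <= A -> 0 <= E ->
  (forall n, (M <= n)%N -> c n = 0) ->
  (forall n, `|d n| <= A * `|c n.+1| + E * `|c n| + A * `|prev_coef c n|) ->
  \sum_(n < M.+1) d n ^+ 2 <= (2 * A + E) ^+ 2 * \sum_(n < M) c n ^+ 2.
Proof.
move=> A0 E0 cM dle.
have dsq n : d n ^+ 2 <=
    (2 * A + E) * (A * c n.+1 ^+ 2 + E * c n ^+ 2 + A * prev_coef c n ^+ 2).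
  rewrite -(real_normK (num_real (d n))) -(real_normK (num_real (c n.+1))).
  rewrite -(real_normK (num_real (c n))) -(real_normK (num_real (prev_coef c n))).
  set x := `|c n.+1| in dle *; set y := `|c n|; set z := `|prev_coef c n|.
  have h0 : 0 <= A * x + E * y + A * z by rewrite !addr_ge0 ?mulr_ge0 ?normr_ge0.
  apply: (@le_trans _ _ ((A * x + E * y + A * z) ^+ 2)).
    by rewrite lerXn2r ?nnegrE ?normr_ge0 ?h0//; exact: dle.
  rewrite -subr_ge0 (_ : _ - _ = A * E * (x - y) ^+ 2 + A ^+ 2 * (x - z) ^+ 2
    + A * E * (y - z) ^+ 2); last by ring.
  by rewrite !addr_ge0// mulr_ge0 ?sqr_ge0 ?mulr_ge0.
set T := \sum_(n < M) c n ^+ 2.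
have T1 : \sum_(n < M.+1) c n ^+ 2 = T.
  by rewrite big_ord_recr /= cM// expr0n addr0.
have T2 : \sum_(n < M.+1) c n.+1 ^+ 2 <= T.
  have <- : \sum_(n < M.+2) c n ^+ 2 = T.
    by rewrite big_ord_recr /= T1 cM// expr0n addr0.
  by rewrite [leRHS]big_ord_recl /= lerDr sqr_ge0.
have T3 : \sum_(n < M.+1) prev_coef c n ^+ 2 = T.
  by rewrite big_ord_recl /= expr0n add0r.
apply: (@le_trans _ _ ((2 * A + E) * (A * T + E * T + A * T))); last first.
  by rewrite le_eqVlt; apply/orP; left; apply/eqP; ring.
apply: le_trans (ler_sum _ (fun (n : 'I_M.+1) _ => dsq n)) _.
rewrite -mulr_sumr ler_wpM2l ?addr_ge0 ?mulr_ge0//.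
by rewrite !big_split -!mulr_sumr /= T1 T3 !lerD2r ler_wpM2l.
Qed.

Section Functional.
Variables (L : {scalar {poly R}}) (p : nat -> {poly R}) (a b : nat -> R).
Hypotheses (onp : orthonormal L p) (rec : three_term p a b).

Lemma jacobi_coef (f : {poly R}) x n (c := fun n => L (f * p n)) :
  L (('X - x%:P) * f * p n) = a n.+1 * c n.+1 + (b n.+1 - x) * c n + a n * prev_coef c n.
Proof.
have [_ recE] := rec.
have -> : ('X - x%:P) * f * p n = f * ('X * p n) - x *: (f * p n).
  by rewrite -mul_polyC; ring.
rewrite recE !mulrDr -!scalerAr linearB !linearD !(scalarZ L) -!/(c _).
case: n => [|n]; first by rewrite mulr0 linear0 /=; ring.
by rewrite -scalerAr (scalarZ L) -/(c n) /=; ring.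
Qed.

Lemma jacobi_norm (f : {poly R}) x M (d := fun n => L (('X - x%:P) * f * p n)) :
  (size f <= M)%N ->
  L ((('X - x%:P) * f) * (('X - x%:P) * f)) = \sum_(n < M.+1) d n ^+ 2.
Proof.
move=> fM; have sz : (size (('X - x%:P) * f)%R <= M.+1)%N.
  by rewrite (leq_trans (size_polyMleq _ _))// size_XsubC.
by rewrite -(orthonormal_parseval onp M.+1 d) /d -(orthonormal_expand onp sz).
Qed.

Lemma orthonormal_norm (f : {poly R}) M : (size f <= M)%N ->
  L (f * f) = \sum_(n < M) L (f * p n) ^+ 2.
Proof.
move=> fM; rewrite -(orthonormal_parseval onp M (fun n => L (f * p n))).
by rewrite -(orthonormal_expand onp fM).
Qed.

(** Since the coefficients of [f] vanish below [N], only matrix entries already close to their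
    limits act on it. *)
Lemma jacobi_tail_le (f : {poly R}) N x (A E : R) : 0 <= A -> 0 <= E ->
  (forall n, (N <= n)%N -> `|a n| <= A /\ `|b n.+1 - x| <= E) ->
  (forall n, (n < N)%N -> L (f * p n) = 0) ->
  L ((('X - x%:P) * f) * (('X - x%:P) * f)) <= (2 * A + E) ^+ 2 * L (f * f).
Proof.
move=> A0 E0 HN f0.
rewrite (jacobi_norm _ (leqnn (size f))) (orthonormal_norm (leqnn _)).
apply: (@band_sum_le (fun n => L (f * p n))
  (fun n => L (('X - x%:P) * f * p n))) => // n => [fn|]; first exact: (orthonormal_perp onp).
rewrite jacobi_coef; set c := fun n => L (f * p n).
have term k m (B : R) : 0 <= B -> ((N <= m)%N -> `|k| <= B) -> `|k * c m| <= B * `|c m|.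
  move=> B0 kB; have [Nm|mN] := leqP N m; first by rewrite normrM ler_wpM2r ?kB.
  by rewrite /c f0// mulr0 normr0 mulr0.
rewrite (le_trans (ler_normD _ _))// lerD//.
  rewrite (le_trans (ler_normD _ _))// lerD// term// => Nn.
    by have [] := HN _ Nn.
  by have [] := HN _ Nn.
case: n => [|n] /=; first by rewrite mulr0 normr0 mulr0.
by rewrite term// => Nn; have [] := HN _ (leq_trans Nn (leqnSn n)).
Qed.

End Functional.

(** Comparison of two quadratic forms in finite dimension. Adding one basis vector at a time,
    semidefiniteness gives [L ((s + t) * (s + t)) <= 2 * L (s * s) + 2 * L (t * t)]. *)
Lemma norm_equivalence (L L' : {scalar {poly R}}) (e : nat -> {poly R}) n :
  orthonormal L' e -> (forall f : {poly R}, 0 <= L (f * f)) ->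
  exists2 C : R, 0 <= C & forall f : {poly R}, (size f <= n)%N ->
    L (f * f) <= C * L' (f * f).
Proof.
move=> one Lge0.
have [C C0 CP] : exists2 C : R, 0 <= C & forall c : nat -> R,
    L ((\sum_(i < n) c i *: e i) * (\sum_(i < n) c i *: e i))
      <= C * \sum_(i < n) c i ^+ 2.
  elim: n => [|n [C C0 CP]].
    by exists 0 => // c; rewrite !big_ord0 mulr0 linear0 mulr0.
  exists (2 * C + 2 * L (e n * e n)); first by rewrite addr_ge0// mulr_ge0.
  move=> c; rewrite !big_ord_recr /=.
  set s := \sum_(i < n) _ *: _; set t := \sum_(i < n) _.
  have h := CP c; rewrite -/s -/t in h.
  have t0 : 0 <= t by apply: sumr_ge0 => i _; exact: sqr_ge0.
  have k0 := sqr_ge0 (c n).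
  have := Lge0 (s - c n *: e n).
  have -> : L ((s - c n *: e n) * (s - c n *: e n)) =
    L (s * s) - 2 * L (s * (c n *: e n)) + c n ^+ 2 * L (e n * e n).
    rewrite (_ : _ * _ = s * s - (2 : R) *: (s * (c n *: e n))
      + (c n ^+ 2) *: (e n * e n)).
      by rewrite linearD linearB !(scalarZ L).
    rewrite -!mul_polyC !polyCM; ring.
  have -> : L ((s + c n *: e n) * (s + c n *: e n)) =
    L (s * s) + 2 * L (s * (c n *: e n)) + c n ^+ 2 * L (e n * e n).
    rewrite (_ : _ * _ = s * s + (2 : R) *: (s * (c n *: e n))
      + (c n ^+ 2) *: (e n * e n)).
      by rewrite !linearD !(scalarZ L).
    rewrite -!mul_polyC !polyCM; ring.
  have := Lge0 (e n); nra.
exists C => // f fn; have [c ->] := orthonormal_span one fn.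
by rewrite (orthonormal_parseval one).
Qed.

(** There are [N] linear conditions on the [N.+1] coefficients of [q], so the matrix [M] has a
    nonzero left kernel. *)
Lemma exists_perp (L : {scalar {poly R}}) (p : nat -> {poly R}) (h : {poly R}) N :
  exists q : {poly R}, [/\ q != 0, (size q <= N.+1)%N &
    forall j, (j < N)%N -> L (q * h * p j) = 0].
Proof.
pose M : 'M[R]_(N.+1, N) := \matrix_(i, j) L ('X^i * h * p j).
have kM : kermx M != 0.
  rewrite -mxrank_eq0 mxrank_ker subn_eq0 -ltnNge ltnS; exact: rank_leq_col.
pose v := nz_row (kermx M).
have v0 : v != 0 by rewrite nz_row_eq0.
have vM : v *m M = 0 by apply/sub_kermxP; exact: nz_row_sub.
exists (rVpoly v); split.
- apply: contra_neq v0 => v0; apply/rowP => i.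
  by rewrite -coef_rVpoly_ord v0 coef0 mxE.
- exact: size_poly.
move=> j jN; have := congr1 (fun w : 'rV[R]_N => w 0 (Ordinal jN)) vM.
rewrite !mxE => <-.
have -> : rVpoly v = \sum_(i < N.+1) v 0 i *: 'X^i.
  have {1}<- : \poly_(i < N.+1) (rVpoly v)`_i = rVpoly v.
    apply/polyP => i; rewrite coef_poly; case: ltnP => // Ni.
    by rewrite nth_default// (leq_trans (size_poly _ _)).
  by rewrite poly_def; apply: eq_bigr => i _; rewrite coef_rVpoly_ord.
rewrite !mulr_suml linear_sum /=; apply: eq_bigr => i _.
by rewrite mxE -!scalerAl (scalarZ L).
Qed.

(* Shifted index: [chebyshev_U t n] is $U_{n-1}(t/2)$. *)
Fixpoint chebyshev_U (t : R) n : R :=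
  if n is m.+1 then
    if m is k.+1 then t * chebyshev_U t m - chebyshev_U t k else 1
  else 0.
Arguments chebyshev_U : simpl never.

(** A quadratic form conserved by the recurrence; for [|t| < 2] it is positive definite, which
    yields the two bounds that follow. *)
Lemma chebyshev_U_invariant t n :
  chebyshev_U t n.+1 ^+ 2 - t * chebyshev_U t n * chebyshev_U t n.+1
    + chebyshev_U t n ^+ 2 = 1.
Proof.
elim: n => [|n IH]; first by rewrite /chebyshev_U; ring.
have -> : chebyshev_U t n.+2 = t * chebyshev_U t n.+1 - chebyshev_U t n by [].
by rewrite -[RHS]IH; ring.
Qed.

Lemma chebyshev_U_bounded t n : `|t| < 2 ->
  chebyshev_U t n ^+ 2 <= (1 - `|t| / 2)^-1.
Proof.
move=> t2; have k0 : 0 < 1 - `|t| / 2 by lra.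
rewrite -[leRHS]mul1r ler_pdivlMr//.
have := chebyshev_U_invariant t n.
set u := chebyshev_U t n; set v := chebyshev_U t n.+1 => e.
have h : t * u * v <= `|t| * ((u ^+ 2 + v ^+ 2) / 2).
  rewrite -mulrA (le_trans (ler_norm _))// normrM ler_wpM2l//.
  rewrite normrM -(real_normK (num_real u)) -(real_normK (num_real v)).
  by have := sqr_ge0 (`|u| - `|v|); lra.
by have := sqr_ge0 v; nra.
Qed.

(** The invariant is at most [2 * (u ^+ 2 + v ^+ 2)], so each pair of consecutive terms contributes
    at least 1/2. *)
Lemma chebyshev_U_sum_ge t m : `|t| < 2 ->
  m%:R / 2 <= \sum_(k < m.*2) chebyshev_U t k ^+ 2.
Proof.
move=> t2; elim: m => [|m IH]; first by rewrite mul0r big_ord0.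
rewrite doubleS !big_ord_recr /=.
have := chebyshev_U_invariant t m.*2.
set u := chebyshev_U t m.*2; set v := chebyshev_U t m.*2.+1 => e.
have h : - (t * u * v) <= 2 * ((u ^+ 2 + v ^+ 2) / 2).
  rewrite -mulrA (le_trans (ler_norm _))// normrN normrM ler_pM// ?(ltW t2)//.
  rewrite normrM -(real_normK (num_real u)) -(real_normK (num_real v)).
  by have := sqr_ge0 (`|u| - `|v|); lra.
rewrite -natr1; lra.
Qed.

End Jacobi.

(** * Approximate eigenvectors inside the interval *)

Section Weyl.
Context {R : realType}.

Lemma sum_eqn_le1 M j : \sum_(n < M) (nat_of_ord n == j)%:R <= (1 : R).
Proof.
have [jM|Mj] := ltnP j M; last first.
  rewrite big1 ?ler01// => i _.
  by rewrite (ltn_eqF (leq_trans (ltn_ord i) Mj)).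
rewrite (bigD1 (Ordinal jM)) //= eqxx big1 ?addr0// => i.
by rewrite -val_eqE /= => /negPf ->.
Qed.

(* By the recurrence for [chebyshev_U], the left-hand side vanishes except at the
   three places where the truncation is visible. *)
Lemma truncated_chebyshev_laplacian (t : R) N m
  (c := fun n => if (n < N + m.+2)%N then chebyshev_U t (n - N) else 0) n :
  `|t| < 2 ->
  (c n.+1 - t * c n + prev_coef c n) ^+ 2 <= (1 - `|t| / 2)^-1 *
    ((n == N)%:R + (n == N + m.+1)%N%:R + (n == N + m.+2)%N%:R).
Proof.
move=> t2; set K := (1 - `|t| / 2)^-1.
have U_le k : chebyshev_U t k ^+ 2 <= K by exact: chebyshev_U_bounded.
have K0 : 0 <= K := le_trans (sqr_ge0 _) (U_le 0%N).
have indic_ge (r : R) (P Q S : bool) : r ^+ 2 <= K -> P || Q || S ->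
    r ^+ 2 <= K * (P%:R + Q%:R + S%:R).
  move=> rK PQS; apply: (le_trans rK); rewrite ler_peMr//.
  by case: P Q S PQS => [] [] []; rewrite //= => _; lra.
have c0 j : (j <= N)%N -> c j = 0.
  by move=> jN; rewrite /c (_ : j - N = 0)%N ?if_same//; lia.
have prev0 j : (j <= N)%N -> prev_coef c j = 0.
  by case: j => //= j jN; rewrite c0// ltnW.
have [nN|Nn] := ltnP n N.
  rewrite !c0 ?prev0// 1?ltnW// mulr0 subrr addr0 expr0n /=.
  by rewrite mulr_ge0// !addr_ge0.
have [->|nN] := eqVneq n N.
  apply: indic_ge; last by [].
  have -> : c N.+1 = 1 by rewrite /c (_ : N.+1 - N = 1)%N ?ifT//; lia.
  rewrite c0// prev0// mulr0 subr0 addr0.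
  exact: (U_le 1%N).
have [k nE] : exists k, n = (N + k.+1)%N by exists (n - N).-1; lia.
have pc : prev_coef c n = if (N + k < N + m.+2)%N then chebyshev_U t k else 0.
  by rewrite nE addnS /= /c addKn.
have cn : c n = if (N + k.+1 < N + m.+2)%N then chebyshev_U t k.+1 else 0.
  by rewrite nE /c addKn.
have c1 : c n.+1 = if (N + k.+2 < N + m.+2)%N then chebyshev_U t k.+2 else 0.
  by rewrite nE -addnS /c addKn.
have rec : chebyshev_U t k.+2 = t * chebyshev_U t k.+1 - chebyshev_U t k by [].
rewrite pc cn c1 nE !ltn_add2l !eqn_add2l.
(* For [k < m] all three values are kept and the recurrence cancels them; [k = m] and [k = m.+1] see
   the cut, and beyond it everything is 0. *)
have [km|mk|km] := ltngtP k m.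
- rewrite !ltnS km (ltnW km) (leq_trans (ltnW km) (leqnSn m)) rec.
  rewrite [X in X ^+ 2](_ : _ = 0); last by ring.
  by rewrite expr0n /= mulr_ge0// !addr_ge0.
- have [km1|km1] := eqVneq k m.+1.
    rewrite km1 ltnn ltnSn (_ : m.+3 < m.+2 = false)%N; last by lia.
    rewrite mulr0 subrr add0r; apply: indic_ge => //.
    by rewrite eqxx !orbT.
  have -> : (k < m.+2)%N = false by lia.
  have -> : (k.+1 < m.+2)%N = false by lia.
  have -> : (k.+2 < m.+2)%N = false by lia.
  by rewrite mulr0 subrr addr0 expr0n /= mulr_ge0// !addr_ge0.
rewrite km !ltnS leqnn ltnn leqnSn; apply: indic_ge; last by rewrite eqxx !orbT.
rewrite [X in X ^+ 2](_ : _ = - chebyshev_U t m.+2) ?sqrrN// -km rec; ring.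
Qed.

(** The coefficients of [f] are Chebyshev values on a long window starting at [N]. The error splits
    into [u], from the deviation of [a_] and [b_] from their limits, and [a * w], from the ends of
    the window. The first is small relative to [f], the second is bounded while the norm of [f]
    grows with the window. *)
Lemma weyl_vector (L : {scalar {poly R}}) (p : nat -> {poly R}) (a_ b_ : nat -> R)
    (a b x eps : R) :
  orthonormal L p -> three_term p a_ b_ -> a_ n @[n --> \oo] --> a ->
  b_ n @[n --> \oo] --> b -> 0 < a -> `|x - b| < 2 * a -> 0 < eps ->
  exists f : {poly R}, L ((('X - x%:P) * f) * (('X - x%:P) * f)) < eps ^+ 2 * L (f * f).
Proof.
move=> onp rec aa bb a0 xb eps0.
pose t := (x - b) / a.
have t2 : `|t| < 2 by rewrite normrM normfV (gtr0_norm a0) ltr_pdivrMr.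
(* This makes [(2 * e + e) ^+ 2 = eps ^+ 2 / 4], so that twice the contribution of [u] uses half of
   the allowed [eps ^+ 2]. *)
pose e := eps / 6; have e0 : 0 < e by rewrite divr_gt0.
have ab_near : \forall n \near \oo, `|a_ n - a| <= e /\ `|b_ n.+1 - b| <= e.
  have b1 : b_ n.+1 @[n --> \oo] --> b by rewrite cvg_shiftS.
  exact: filterI (cvgr_distC_le _ _ aa _ e0) (cvgr_distC_le _ _ b1 _ e0).
have [N _ HN] := ab_near.
pose K := (1 - `|t| / 2)^-1.
have K0 : 0 <= K by apply: le_trans (chebyshev_U_bounded 0 t2); exact: sqr_ge0.
pose W := 6 * (a ^+ 2 * (K * 3)).
have W0 : 0 <= W by rewrite /W; have := mulr_ge0 (sqr_ge0 a) K0; lra.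
(* The ends of the window contribute at most [W / 3], while the other half of the allowance is at
   least [eps ^+ 2 * m.+1 / 4 > W]. *)
have [m mW] : exists m : nat, 4 * W / eps ^+ 2 < m%:R.
  by exists (Num.bound (4 * W / eps ^+ 2)); apply: archi_boundP;
    rewrite divr_ge0 ?sqr_ge0// (mulr_ge0 (ler0n _ 4) W0).
pose M := (N + (m.+1).*2)%N.
pose c n := if (n < N + (m.*2).+2)%N then chebyshev_U t (n - N) else 0.
pose f := \sum_(i < M) c i *: p i.
exists f.
have fc n : L (f * p n) = c n.
  by rewrite (orthonormal_sumr onp) /c /M doubleS; case: (n < _)%N.
have szf : (size f <= M)%N.
  apply: (leq_trans (size_sum _ _ _)); apply/bigmax_leqP => i _.
  by have [szp _ _] := onp; rewrite (leq_trans (size_scale_leq _ _))// szp.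
rewrite (jacobi_norm onp _ szf) (orthonormal_norm onp szf).
under [X in _ < _ * X]eq_bigr do rewrite fc.
pose u n := (a_ n.+1 - a) * c n.+1 + (b_ n.+1 - b) * c n + (a_ n - a) * prev_coef c n.
pose w n := c n.+1 - t * c n + prev_coef c n.
have dE n : L (('X - x%:P) * f * p n) = u n + a * w n.
  rewrite (jacobi_coef L rec) !fc (_ : prev_coef _ n = prev_coef c n); last first.
    by case: n => //= n; rewrite fc.
  by rewrite /u /w /t; field; rewrite gt_eqF.
under [X in X < _]eq_bigr do rewrite dE.
have d2 n : (u n + a * w n) ^+ 2 <= 2 * u n ^+ 2 + 2 * a ^+ 2 * w n ^+ 2.
  by have := sqr_ge0 (u n - a * w n); lra.
set T := \sum_(n < M) c n ^+ 2.
have c0 n : (n <= N)%N -> c n = 0.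
  by move=> nN; rewrite /c (_ : n - N = 0)%N ?if_same//; lia.
have usum : \sum_(n < M.+1) u n ^+ 2 <= (2 * e + e) ^+ 2 * T.
  apply: band_sum_le; rewrite ?(ltW e0)// => n.
    by move=> Mn; rewrite /c ifN// -leqNgt; rewrite /M in Mn; lia.
  have term k j : ((N <= j)%N -> `|k| <= e) -> `|k * c j| <= e * `|c j|.
    move=> ke; have [Nj|jN] := leqP N j; first by rewrite normrM ler_wpM2r ?ke.
    by rewrite c0 ?mulr0 ?normr0 ?mulr0// ltnW.
  rewrite /u (le_trans (ler_normD _ _))// lerD//.
    rewrite (le_trans (ler_normD _ _))// lerD// term// => Nn.
      by have [] := HN _ Nn.
    by have [] := HN _ Nn.
  case: n => [|n] /=; first by rewrite mulr0 normr0 mulr0.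
  by rewrite term// => Nn; have [] := HN _ (leq_trans Nn (leqnSn n)).
have wsum : \sum_(n < M.+1) w n ^+ 2 <= K * 3.
  apply: (@le_trans _ _ (\sum_(n < M.+1) K *
    ((nat_of_ord n == N)%:R + (nat_of_ord n == N + (m.*2).+1)%N%:R
      + (nat_of_ord n == N + (m.*2).+2)%N%:R))).
    by apply: ler_sum => n _; exact: truncated_chebyshev_laplacian.
  rewrite -mulr_sumr !big_split /= ler_wpM2l//.
  have := sum_eqn_le1 M.+1 N; have := sum_eqn_le1 M.+1 (N + (m.*2).+1).
  by have := sum_eqn_le1 M.+1 (N + (m.*2).+2); lra.
have Tge : m.+1%:R / 2 <= T.
  apply: (le_trans (chebyshev_U_sum_ge m.+1 t2)).
  rewrite /T /M big_split_ord /= ler_wpDl ?sumr_ge0// => [i _|]; first exact: sqr_ge0.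
  apply: ler_sum => i _; rewrite /c addKn ifT// ltn_add2l -doubleS; exact: ltn_ord.
have : \sum_(n < M.+1) (u n + a * w n) ^+ 2 <= 2 * (\sum_(n < M.+1) u n ^+ 2)
    + 2 * a ^+ 2 * (\sum_(n < M.+1) w n ^+ 2).
  rewrite !mulr_sumr -big_split /=; apply: ler_sum => i _; exact: d2.
move/le_lt_trans; apply.
have eps2 : 0 < eps ^+ 2 by rewrite exprn_gt0.
have : eps ^+ 2 * (m.+1%:R / 2) <= eps ^+ 2 * T by rewrite ler_wpM2l// ltW.
move: mW; rewrite ltr_pdivrMr// -natr1 => mW.
have : 2 * a ^+ 2 * (\sum_(n < M.+1) w n ^+ 2) <= 2 * a ^+ 2 * (K * 3).
  by rewrite ler_wpM2l// mulr_ge0 ?sqr_ge0.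
move: usum; rewrite (_ : (2 * e + e) ^+ 2 = eps ^+ 2 / 4); last by rewrite /e; field.
move: mW; rewrite /W; nra.
Unshelve. all: by end_near. Qed.

End Weyl.

(** * The moment functional of a measure *)

Section MomentFunctional.
Context {R : realType} (mu : {measure set (measurableTypeR R) -> \bar R}).
Hypothesis fm : finite_moments mu.
Implicit Types (f h : {poly R}) (D : set (measurableTypeR R)).

Lemma measurable_horner D f : measurable_fun D (horner f : measurableTypeR R -> R).
Proof.
apply: measurable_funTS; apply: continuous_measurable_fun; exact: continuous_horner.
Qed.

Lemma integrable_horner D f : measurable D ->
  mu.-integrable D (EFin \o horner f).
Proof.
move=> mD; apply: (integrableS measurableT) => //.
have -> : EFin \o horner f = (fun x => \sum_(i < size f) (f`_i * x ^+ i)%:E)%E.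
  by apply/funext => x; rewrite /= horner_coef sumEFin.
apply: integrable_sum => // i _.
have -> : (fun x : measurableTypeR R => (f`_i * x ^+ i)%:E) =
    (fun x => (f`_i)%:E * ('X^i).[x]%:E)%E.
  by apply/funext => x; rewrite hornerXn EFinM.
apply: integrableZl => //; apply/integrableP; split.
  by apply/measurable_EFinP; exact: measurable_horner.
apply: le_lt_trans (fm i); rewrite le_eqVlt; apply/orP; left; apply/eqP.
by apply: eq_integral => x _; rewrite /= hornerXn normrX.
Qed.

(** Measurability is an argument so that linearity, which is derived from it, can be attached to
    [moment mD] as a canonical structure. *)
Definition moment (D : set (measurableTypeR R)) (mD : measurable D) f : R :=
  \int[mu]_(x in D) f.[x].

Lemma moment_is_scalar D (mD : measurable D) : scalar (moment mD).
Proof.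
move=> k f h; rewrite /moment.
under eq_Rintegral do rewrite hornerD hornerZ.
rewrite RintegralD//.
- by rewrite RintegralZl//; exact: integrable_horner.
- rewrite (_ : EFin \o _ = EFin \o horner (k *: f)); first exact: integrable_horner.
  by apply/funext => x; rewrite /= hornerZ.
- exact: integrable_horner.
Qed.

HB.instance Definition _ D (mD : measurable D) :=
  GRing.isLinear.Build _ _ _ _ (moment mD) (moment_is_scalar mD).

Definition moment_functional D (mD : measurable D) : {scalar {poly R}} := moment mD.

Lemma moment_le D (mD : measurable D) f h :
  (forall x, D x -> f.[x] <= h.[x]) -> moment mD f <= moment mD h.
Proof. by move=> fh; apply: le_Rintegral => //; exact: integrable_horner. Qed.

Lemma moment_ge0 D (mD : measurable D) f :
  (forall x, D x -> 0 <= f.[x]) -> 0 <= moment mD f.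
Proof. exact: Rintegral_ge0. Qed.

Lemma moment_subset D E (mD : measurable D) (mE : measurable E) f :
  D `<=` E -> (forall x, E x -> 0 <= f.[x]) -> moment mD f <= moment mE f.
Proof.
move=> DE f0; apply: fine_le.
- exact: integrable_fin_num (integrable_horner f mD).
- exact: integrable_fin_num (integrable_horner f mE).
apply: ge0_subset_integral => //.
by apply/measurable_EFinP; exact: measurable_horner.
Qed.

Lemma moment_null D E (mD : measurable D) (mE : measurable E) f :
  mu E = 0%E -> (forall x, D x -> ~ E x -> 0 <= f.[x]) -> 0 <= moment mD f.
Proof.
move=> E0 f0; rewrite /moment /Rintegral (negligible_integral mE)//.
  by apply: fine_ge0; apply: integral_ge0 => x [Dx Ex]; rewrite lee_fin f0.
exact: integrable_horner.
Qed.

Lemma open_measurable_real (U : set R) : open U ->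
  measurable (U : set (measurableTypeR R)).
Proof. exact: open_measurable. Qed.

Lemma moment_polyC D (mD : measurable D) c : moment mD c%:P = c * fine (mu D).
Proof.
rewrite -Rintegral_cst// /moment; apply: eq_Rintegral => x _.
by rewrite hornerC.
Qed.

Lemma finite_moments_fin_num : fin_num_fun mu.
Proof.
apply: lty_fin_num_fun; rewrite -(mul1e (mu _)) -integral_cst//.
apply: le_lt_trans (fm 0%N); rewrite le_eqVlt; apply/orP; left; apply/eqP.
by apply: eq_integral => x _; rewrite expr0.
Qed.

Lemma infinite_set_not_root (A : set R) f : f != 0 -> infinite_set A ->
  exists2 y, A y & f.[y] != 0.
Proof.
move=> f0 /(@infinite_set_fset R A (size f))[B BA sB].
apply: contrapT => nex.
suff : (size (finmap.enum_fset B) < size f)%N by rewrite ltnNge sB.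
apply: max_poly_roots => //; last exact: finmap.fset_uniq.
apply/allP => y yB; apply/rootP/eqP; apply: contrapT => /negP fy.
by apply: nex; exists y => //; exact: BA.
Qed.

(** A nonzero [f] has finitely many roots, so it is nonzero at some support point in [D]; near that
    point [f * f] exceeds a positive constant on an open set of positive measure. *)
Lemma moment_posdef D (mD : measurable D) : open (D : set R) ->
  infinite_set (msupport mu `&` D) -> posdef (moment_functional mD).
Proof.
move=> oD infD f f0.
have [y [sy Dy] fy0] := infinite_set_not_root f0 infD.
have c_gt0 : 0 < (f * f).[y] / 2.
  by rewrite divr_gt0// hornerM -expr2 exprn_even_gt0.
set c := _ / 2 in c_gt0.
pose U : set R := D `&` [set z | c < (f * f).[z]].
have oU : open U.
  apply: openI => //.
  apply: (@open_comp _ _ (horner (f * f)) [set t | c < t]); last exact: open_gt.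
  by move=> z _; exact: continuous_horner.
have mU := open_measurable_real oU.
have Uy : U y by split => //=; move: c_gt0; rewrite /c; lra.
have muU := sy U oU Uy.
apply: (@lt_le_trans _ _ (moment mU c%:P)).
  rewrite moment_polyC mulr_gt0// fine_gt0// muU /=.
  by rewrite ltey_eq finite_moments_fin_num.
apply: (@le_trans _ _ (moment mU (f * f))).
  by apply: moment_le => z [_ /ltW]; rewrite hornerC.
apply: moment_subset => [z []//|z _].
by rewrite hornerM -expr2 sqr_ge0.
Qed.

Lemma poly_inner_moment f h :
  poly_inner mu f h = moment_functional measurableT (f * h).
Proof. by apply: eq_Rintegral => x _; rewrite hornerM. Qed.

Lemma orthonormal_orthonormal_poly : posdef (moment_functional measurableT) ->
  orthonormal (moment_functional measurableT) (orthonormal_poly mu).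
Proof.
move=> pd.
rewrite (_ : orthonormal_poly mu = gs_poly (moment_functional measurableT)).
  exact: orthonormal_gs_poly pd.
apply/funext => n; apply: orthonormal_poly_gs => f h.
exact: poly_inner_moment.
Qed.

End MomentFunctional.

(** * The essential support *)

Section EssentialSupport.
Context {R : realType} (mu : {measure set (measurableTypeR R) -> \bar R}).
Variables (a_ b_ : nat -> R) (a b : R).
Hypotheses (mu_nontrivial : nontrivial_measure mu) (fm : finite_moments mu)
  (mu_coef : recurrence_coefficients mu a_ b_)
  (a_cvg : a_ n @[n --> \oo] --> a) (a_gt0 : 0 < a) (b_cvg : b_ n @[n --> \oo] --> b).

Let mT : measurable [set: measurableTypeR R] := measurableT.
Let L := moment_functional fm mT.
Let p := orthonormal_poly mu.

Lemma posdef_moment : posdef L.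
Proof.
apply: moment_posdef; first exact: openT.
by rewrite setIT.
Qed.

Let onp : orthonormal L p := orthonormal_orthonormal_poly posdef_moment.

(** If a ball of radius [d] around [x] were null, multiplication by ['X - x%:P] would enlarge every
    norm by at least the factor [d], against [weyl_vector]. *)
Lemma msupport_interior x : `|x - b| < 2 * a -> msupport mu x.
Proof.
move=> xb U oU Ux; rewrite lt0e measure_ge0 andbT; apply/eqP => muU0.
have /nbhs_ballP[d /= d0 dU] := open_nbhs_nbhs (conj oU Ux).
have [f] := weyl_vector onp mu_coef a_cvg b_cvg a_gt0 xb d0.
rewrite ltNge => /negP; apply.
rewrite -subr_ge0 -(scalarZ L) -linearB /=.
apply: (moment_null fm mT (open_measurable_real oU) muU0) => y _ nUy.
rewrite !(hornerD, hornerN, hornerM, hornerZ, hornerX, hornerC).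
have : d <= `|y - x|.
  by rewrite leNgt; apply/negP => yx; apply: nUy; apply: dU; rewrite /ball /= distrC.
move=> dy; rewrite (_ : _ - _ = f.[y] ^+ 2 * ((y - x) ^+ 2 - d ^+ 2)); last by ring.
rewrite mulr_ge0 ?sqr_ge0// subr_ge0 -[leRHS]real_normK ?num_real//.
by rewrite lerXn2r ?nnegrE ?normr_ge0 ?(ltW d0).
Qed.

(** To be used with [u = (x - b) ^+ 2] and [r = q.[x] ^+ 2]. The first term is negative only for
    [u < k], where the power is at most that of [k / l] and the second term compensates; for [u > l]
    the power is at least 1. *)
Lemma power_cutoff (k l u r : R) m : 0 < k -> k < l -> 0 <= u -> 0 <= r ->
  (u - k) * (r * (u / l) ^+ m.*2) + k * (k / l) ^+ m.*2 * r >=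
    (if l < u then l - k else 0) * r.
Proof.
move=> k0 kl u0 r0; have l0 : 0 < l by lra.
have ul0 : 0 <= u / l by rewrite divr_ge0// ltW.
have kl0 : 0 <= k / l by rewrite divr_ge0// ltW.
set P := (u / l) ^+ m.*2; set Q := (k / l) ^+ m.*2.
have P0 : 0 <= P by rewrite exprn_ge0.
have Q0 : 0 <= Q by rewrite exprn_ge0.
have -> : (u - k) * (r * P) + k * Q * r = ((u - k) * P + k * Q) * r by ring.
rewrite ler_wpM2r//; case: ltP => lu.
  have P1 : 1 <= P by rewrite exprn_ege1// ler_pdivlMr// mul1r ltW.
  have : 0 <= k * Q by rewrite mulr_ge0// ltW.
  nra.
have [uk|ku] := leP u k; last by rewrite addr_ge0// mulr_ge0// ?ltW// subr_gt0.
have PQ : P <= Q by rewrite lerXn2r// ler_pM2r ?invr_gt0.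
have : 0 <= k * Q by rewrite mulr_ge0// ltW.
nra.
Qed.

Lemma open_dist_gt c : open [set x : R | c < `|x - b|].
Proof.
apply: (@open_comp _ _ (fun x : R => `|x - b|) [set t | c < t]); last exact: open_gt.
by move=> x _; apply: cvg_norm; apply: cvgB; [exact: cvg_id|exact: cvg_cst].
Qed.

(** Otherwise the restriction [LD] of the functional to [D] is positive definite. Integrating the
    cutoff inequality for [f = q * g] and using [tail] gives [(l - k) * LD (q * q) <= k * (k / l) ^+
    m.*2 * C * LD (q * q)], which fails for large [m]. *)
Lemma finite_support_outside c : 2 * a < c ->
  finite_set (msupport mu `&` [set x | c < `|x - b|]).
Proof.
move=> ac; apply: contrapT => inf.
pose D : set R := [set x | c < `|x - b|].
have oD : open D := @open_dist_gt c.
have mD := open_measurable_real oD.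
pose LD := moment_functional fm mD.
have pdD : posdef LD by exact: moment_posdef.
(* With this [e] the norm bound [c0 = 2 * a + 3 * e] of the tail stays below [c]. *)
pose e := (c - 2 * a) / 4; have e0 : 0 < e by rewrite /e; lra.
have ab_near : \forall n \near \oo, `|a_ n - a| <= e /\ `|b_ n.+1 - b| <= e.
  have b1 : b_ n.+1 @[n --> \oo] --> b by rewrite cvg_shiftS.
  exact: filterI (cvgr_distC_le _ _ a_cvg _ e0) (cvgr_distC_le _ _ b1 _ e0).
have [N _ HN] := ab_near.
pose c0 := 2 * (a + e) + e.
have a0 := a_gt0.
have c0_gt0 : 0 < c0 by rewrite /c0; lra.
have c0c : c0 < c by rewrite /c0 /e; lra.
have Lge0 (f : {poly R}) : 0 <= L (f * f).
  by apply: moment_ge0 => x _; rewrite hornerM -expr2 sqr_ge0.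
(* The size of [q] will be at most [N.+1] whatever the power [m], so [C] is fixed before [m] is
   chosen. *)
have [C C0 LC] := norm_equivalence N.+1 (orthonormal_gs_poly pdD) Lge0.
pose k := c0 ^+ 2; pose l := c ^+ 2.
have k0 : 0 < k by rewrite exprn_gt0.
have kl : k < l by rewrite /k /l ltrXn2r// ?nnegrE ?ltW//; lra.
have l0 : 0 < l := lt_trans k0 kl.
have [m mP] : exists m : nat, k * (k / l) ^+ m.*2 * C < l - k.
  have z1 : `|(k / l) ^+ 2| < 1.
    rewrite ger0_norm ?sqr_ge0// expr_lt1 ?divr_ge0 ?ltW// ltr_pdivrMr// mul1r//.
  have zm : k * (k / l) ^+ 2 ^+ m * C @[m --> \oo] --> 0.
    rewrite -(mul0r C) -(mulr0 k); apply: cvgM; last exact: cvg_cst.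
    by apply: cvgM; [exact: cvg_cst|exact: cvg_expr].
  have lk0 : 0 < l - k by rewrite subr_gt0.
  have [m _ Hm] := cvgr_lt _ zm _ lk0.
  by exists m; have := Hm m (leqnn m); rewrite /= -exprM mul2n.
pose w : {poly R} := 'X - b%:P; pose g := (l^-1 *: (w * w)) ^+ m.
have [q [q0 szq perp]] := exists_perp L p g N.
pose f := q * g.
have LDq : 0 < LD (q * q) by exact: pdD.
have tail : L ((w * f) * (w * f)) <= k * L (f * f).
  apply: (jacobi_tail_le onp mu_coef (N := N)) => //; rewrite ?(ltW e0)//; first by lra.
  move=> n Nn; have [h1 h2] := HN n Nn; split => //.
  rewrite -(subrK a (a_ n)) addrC (le_trans (ler_normD _ _))// lerD//.
  by rewrite gtr0_norm.
pose H := w * f * (w * f) - k *: (f * f) + (k * (k / l) ^+ m.*2) *: (q * q).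
have HE x : H.[x] = ((x - b) ^+ 2 - k) * (q.[x] ^+ 2 * ((x - b) ^+ 2 / l) ^+ m.*2)
      + k * (k / l) ^+ m.*2 * q.[x] ^+ 2.
  have gE : g.[x] = ((x - b) ^+ 2 / l) ^+ m.
    rewrite horner_exp hornerZ hornerM hornerXsubC -expr2 mulrC; by [].
  have -> : ((x - b) ^+ 2 / l) ^+ m.*2 = g.[x] ^+ 2 by rewrite gE -exprM muln2.
  set Q := k * _; rewrite /H -/Q /f /w.
  rewrite !(hornerD, hornerN, hornerM, hornerZ, hornerX, hornerC); ring.
have Hge x := @power_cutoff k l ((x - b) ^+ 2) (q.[x] ^+ 2) m k0 kl
  (sqr_ge0 _) (sqr_ge0 _).
have H0 x : 0 <= H.[x].
  rewrite HE (le_trans _ (Hge x))// mulr_ge0 ?sqr_ge0//.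
  by case: ifP => // _; rewrite subr_ge0 ltW.
have h1 : (l - k) * LD (q * q) <= L H.
  apply: (@le_trans _ _ (LD H)); last exact: moment_subset.
  rewrite -(scalarZ LD); apply: moment_le => // x Dx.
  rewrite hornerZ hornerM -expr2 HE (le_trans _ (Hge x))// ifT//.
  rewrite /l -[ltRHS]real_normK ?num_real// ltrXn2r ?nnegrE//.
  by lra.
move: h1; rewrite /H linearD linearB !(scalarZ L) => h1.
have h2 := LC q szq.
have z : 0 <= k * (k / l) ^+ m.*2 by rewrite mulr_ge0 ?exprn_ge0 ?divr_ge0 ?ltW.
have h3 := ler_wpM2l z h2.
have h4 : k * (k / l) ^+ m.*2 * C * LD (q * q) < (l - k) * LD (q * q) by rewrite ltr_pM2r.
by lra.
Qed.

(** [x] is moved towards [b] by [h]; [h < a] keeps it in the open interval even if it passes [b]. *)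
Lemma spectrum_interior_dense x d : `|x - b| <= 2 * a -> 0 < d ->
  exists y, [/\ y != x, `|x - y| < d & `|y - b| < 2 * a].
Proof.
rewrite ler_distl => /andP[xl xr] d0.
pose h := Num.min d a / 2.
have h0 : 0 < h by rewrite divr_gt0// lt_min d0.
have a0 := a_gt0.
have hd : h < d.
  have : Num.min d a <= d by rewrite ge_min lexx.
  rewrite /h; lra.
have ha : h < a.
  have : Num.min d a <= a by rewrite ge_min lexx orbT.
  rewrite /h; lra.
have [xb|bx] := leP x b.
  exists (x + h); split; first by rewrite gt_eqF// ltrDl.
    by rewrite (_ : x - (x + h) = - h) ?normrN ?gtr0_norm//; ring.
  by rewrite ltr_distl; apply/andP; split; lra.
exists (x - h); split; first by rewrite lt_eqF// ltrBlDr ltrDl.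
  by rewrite (_ : x - (x - h) = h) ?gtr0_norm//; ring.
by rewrite ltr_distl; apply/andP; split; lra.
Qed.

Lemma essential_supportE : essential_support mu = `[b - 2 * a, b + 2 * a]%classic.
Proof.
have itvE x : `[b - 2 * a, b + 2 * a]%classic x <-> `|x - b| <= 2 * a.
  by rewrite /= in_itv /= ler_distl; split.
apply/seteqP; split => x.
  move=> [sx nx]; apply/itvE; rewrite leNgt; apply/negP => ax.
  apply: nx; split; first by rewrite inE.
  pose c := (2 * a + `|x - b|) / 2.
  have ac : 2 * a < c by rewrite /c; lra.
  have cx : c < `|x - b| by rewrite /c; lra.
  have fin := finite_support_outside ac.
  set S := _ `&` _ in fin.
  (* The finitely many other support points at distance more than [c] from [b] are removed, which
     isolates [x]. *)
  exists ([set y | c < `|y - b|] `&` ~` (S `\ x)).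
    apply: open_nbhs_nbhs; split; last by split => //= -[_]; apply.
    apply: openI; first exact: open_dist_gt.
    apply: closed_openC; apply: (accessible_finite_set_closed.1 _).
      exact: hausdorff_accessible (@norm_hausdorff _ _).
    exact: finite_setD.
  apply/seteqP; split => [y [[cy nS] sy]|_ ->].
    by apply: contrapT => yx; apply: nS; split.
  by split => //; split => // -[_]; apply.
move=> /itvE xb.
(* This gives both claims at once: endpoints are in the support as limits, and no point of the
   interval is isolated. *)
have near_x U : nbhs x U -> exists y, [/\ y != x, U y & msupport mu y].
  move=> /nbhs_ballP[d /= d0 dU].
  have [y [yx xy yb]] := spectrum_interior_dense xb d0.
  by exists y; split => //; [exact: dU|exact: msupport_interior].
split.
  move=> U oU Ux; have [y [_ Uy sy]] := near_x U (open_nbhs_nbhs (conj oU Ux)).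
  exact: sy.
move=> [_ [V /near_x[y [yx Vy sy]] VS]].
have : (V `&` msupport mu) y by split.
by rewrite VS => /= e; move: yx; rewrite e eqxx.
Qed.

End EssentialSupport.

(** * Finitely many point masses *)

Section PointMasses.
Context {R : realType}.
Implicit Types (mu nu : {measure set (measurableTypeR R) -> \bar R}).

Let mT : measurable [set: measurableTypeR R] := measurableT.

(** The series starts at 1 and [bv] at 0; [bvSr] accounts for the one extra difference. *)
Lemma bounded_variation_coefficients_bv (u v : nat -> R) :
  bounded_variation_coefficients u v <-> bv u /\ bv v.
Proof.
have ge0 n : (0 <= (`|u n.+1 - u n| + `|v n.+1 - v n|)%:E)%E.
  by rewrite lee_fin addr_ge0.
split=> [fin|[bu bw]].
  have tot_ge0 : (0 <= \sum_(1 <= n <oo) (`|u n.+1 - u n| + `|v n.+1 - v n|)%:E)%E.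
    by apply: nneseries_ge0 => n _ _.
  have [C totE] : exists C : R,
      (\sum_(1 <= n <oo) (`|u n.+1 - u n| + `|v n.+1 - v n|)%:E)%E = C%:E.
    exists (fine (\sum_(1 <= n <oo) (`|u n.+1 - u n| + `|v n.+1 - v n|)%:E)%E).
    by rewrite fineK// ge0_fin_numE.
  have part N : \sum_(n < N) (`|u n.+2 - u n.+1| + `|v n.+2 - v n.+1|) <= C.
    rewrite -lee_fin -totE; apply: le_trans (nneseries_lim_ge N.+1 _); last first.
      by move=> n _ _; exact: ge0.
    by rewrite sumEFin lee_fin big_add1 /= big_mkord.
  split; apply: bvSr; exists C => N; apply: le_trans (part N); apply: ler_sum => n _.
    by rewrite lerDl.
  by rewrite lerDr.
have [C HC] := abs_summableD (abs_summable_norm bu) (abs_summable_norm bw).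
rewrite /bounded_variation_coefficients.
apply: (@le_lt_trans _ _ C%:E); last exact: ltry.
apply: lime_le; first by apply: is_cvg_nneseries => n _ _; exact: ge0.
apply: nearW => n /=; rewrite sumEFin lee_fin.
apply: le_trans (HC n).
rewrite -(big_mkord xpredT (fun n => `|(`|u n.+1 - u n| + `|v n.+1 - v n|)|)).
case: n => [|n]; first by rewrite !big_geq.
rewrite [leRHS]big_ltn//=; apply: ler_wpDl => //.
by apply: ler_sum => i _; exact: ler_norm.
Qed.

Lemma eq_moment mu nu : finite_moments mu -> (forall A, nu A = mu A) ->
  finite_moments nu /\ forall f, moment nu mT f = moment mu mT f.
Proof.
move=> fm numu; split=> [n|f].
  by rewrite (eq_measure_integral mu)// => A _ _; exact: numu.
by rewrite /moment /Rintegral (eq_measure_integral mu)// => A _ _; exact: numu.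
Qed.

Lemma moment_add_mass mu nu (g : {posnum R}) (x : R) : finite_moments mu ->
  (forall A, nu A = mu A + g%:num%:E * dirac (x : measurableTypeR R) A)%E ->
  finite_moments nu /\ forall f, moment nu mT f = add_mass (moment mu mT) g%:num x f.
Proof.
move=> fm nuE.
have g0 : 0 <= g%:num by [].
pose d : {measure set (measurableTypeR R) -> \bar R} :=
  mscale (NngNum g0) (dirac (x : measurableTypeR R)).
have nuadd A : nu A = measure_add mu d A by rewrite measure_addE nuE.
have d_int (f : measurableTypeR R -> R) : measurable_fun setT f -> (forall y, 0 <= f y) ->
    (\int[d]_y (f y)%:E = (g%:num * f x)%:E)%E.
  move=> mf f0; rewrite ge0_integral_mscale//.
  - rewrite integral_dirac//; last by apply/measurable_EFinP.
    by rewrite diracT mul1e EFinM.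
  - by apply/measurable_EFinP.
  - by move=> y _; rewrite lee_fin.
have mX n : measurable_fun [set: measurableTypeR R]
    (fun y : measurableTypeR R => `|y| ^+ n).
  have -> : (fun y : measurableTypeR R => `|y| ^+ n) = (fun y => `|('X^n).[y]|).
    by apply/funext => y; rewrite hornerXn normrX.
  by apply: measurableT_comp => //; exact: measurable_horner.
have fmd : finite_moments d.
  move=> n; rewrite d_int ?ltry// => y; exact: exprn_ge0.
have fmn : finite_moments nu.
  move=> n; rewrite (eq_measure_integral (measure_add mu d)); last first.
    by move=> A _ _; exact: nuadd.
  rewrite ge0_integral_measure_add//; first by rewrite lte_add_pinfty.
  by apply/measurable_EFinP.
split=> // f; rewrite /add_mass /moment /Rintegral.
rewrite (eq_measure_integral (measure_add mu d)); last by move=> A _ _; exact: nuadd.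
rewrite integral_measure_add//; [|exact: integrable_horner..].
rewrite fineD; [|exact: integrable_fin_num (integrable_horner _ _ _)..].
congr (_ + _); rewrite -/(Rintegral d setT (horner f)) -/(moment d mT f).
have sq h : moment d mT (h * h) = g%:num * h.[x] ^+ 2.
  rewrite /moment /Rintegral d_int ?hornerM//=; first exact: measurable_horner.
  by move=> y; rewrite hornerM -expr2 sqr_ge0.
have -> : moment d mT f = moment_functional fmd mT f by [].
(* Polarization: [sq] needs a nonnegative integrand. *)
have fE : f = 4^-1 *: ((f + 1%:P) * (f + 1%:P) - (f - 1%:P) * (f - 1%:P)).
  rewrite polyC1 (_ : _ - _ = (4 : R) *: f); first by rewrite scalerA mulVf ?scale1r.
  by rewrite scaler_nat; ring.
by rewrite {1}fE scalarZ linearB /= !sq !hornerD hornerN hornerC; field.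
Qed.

Lemma orthonormal_ext (L L' : {scalar {poly R}}) p : L =1 L' ->
  orthonormal L p -> orthonormal L' p.
Proof. by move=> LL [h1 h2 h3]; split => // i j; rewrite -LL. Qed.

(** Induction on the number of points, with [ord_max] added last. Asking for some orthonormal system
    keeps Gram-Schmidt out of the induction; uniqueness identifies the system afterwards. *)
Lemma add_point_masses_recurrence mu (a_ b_ : nat -> R) (a b : R) :
  nontrivial_measure mu -> finite_moments mu -> recurrence_coefficients mu a_ b_ ->
  a_ n @[n --> \oo] --> a -> 0 < a -> b_ n @[n --> \oo] --> b ->
  bv a_ -> bv b_ ->
  forall (k : nat) (x : 'I_k -> R) (gamma : 'I_k -> {posnum R})
    nu, (forall A, nu A = add_point_masses mu x gamma A) ->
  (forall j, 2 * a < `|x j - b|) ->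
  exists (fm : finite_moments nu) p a' b',
    [/\ orthonormal (moment_functional fm mT) p, three_term p a' b',
      a' n @[n --> \oo] --> a /\ b' n @[n --> \oo] --> b & bv a' /\ bv b'].
Proof.
move=> nt fm coef aa a0 bb ba b_bv; elim => [|k IH] x gamma nu nuE xb.
  have [fmn momE] : finite_moments nu /\ forall f, moment nu mT f = moment mu mT f.
    by apply: eq_moment => // A; rewrite nuE /add_point_masses big_ord0 adde0.
  exists fmn, (orthonormal_poly mu), a_, b_; split => //.
  apply: (@orthonormal_ext (moment_functional fm mT)) => [f|]; first by rewrite /= momE.
  by apply: orthonormal_orthonormal_poly; exact: posdef_moment.
pose w := widen_ord (leqnSn k).
have [fm1 [p [a1 [b1 [onp rec [a1a b1b] [ba1 bb1]]]]]] :=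
  IH (x \o w) (gamma \o w) (add_point_masses mu (x \o w) (gamma \o w)) (fun=> erefl)
    (fun j => xb (w j)).
have nuS A : nu A = (add_point_masses mu (x \o w) (gamma \o w) A
    + (gamma ord_max)%:num%:E * dirac (x ord_max : measurableTypeR R) A)%E.
  by rewrite nuE /add_point_masses big_ord_recr /= addeA.
have [fmn momE] := moment_add_mass fm1 nuS.
have g0 : 0 < (gamma ord_max)%:num by [].
have [p' [a' [b' [onp' rec' lim' bv']]]] :=
  add_mass_preserves onp rec g0 a0 a1a b1b ba1 bb1 (xb ord_max).
exists fmn, p', a', b'; split => //.
apply: orthonormal_ext onp' => f; by rewrite /= momE.
Qed.

End PointMasses.

(** * Essential support, and stability of the coefficients under added point masses *)

Theorem theorem2p3 (R : realType)
    (mu : {measure set (measurableTypeR R) -> \bar R})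
    (a_ b_ : nat -> R) (a b : R)
    (mu_nontrivial : nontrivial_measure mu)
    (mu_moments : finite_moments mu)
    (mu_coef : recurrence_coefficients mu a_ b_)
    (a_cvg : a_ n @[n --> \oo] --> a) (a_neq0 : a != 0)
    (b_cvg : b_ n @[n --> \oo] --> b)
    (ab_bv : bounded_variation_coefficients a_ b_) :
  essential_support mu = `[b - 2 * a, b + 2 * a]%classic /\
  (forall (k : nat) (x : 'I_k -> R) (gamma : 'I_k -> {posnum R}),
     injective x ->
     (forall j, x j \notin `[b - 2 * a, b + 2 * a]) ->
     let mu_k := add_point_masses mu x gamma in
     (exists at_ bt_ : nat -> R, recurrence_coefficients mu_k at_ bt_) /\
     (forall at_ bt_ : nat -> R, recurrence_coefficients mu_k at_ bt_ ->
        [/\ at_ n @[n --> \oo] --> a,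
            bt_ n @[n --> \oo] --> b &
            bounded_variation_coefficients at_ bt_])).
Proof.
have a_gt0 : 0 < a.
  rewrite lt0r a_neq0 -(cvg_lim _ a_cvg)//=; apply: limr_ge.
    by apply/cvg_ex; exists a.
  by exists 1%N => // n /= n1; rewrite ltW//; case: mu_coef => + _; exact.
split.
  exact: (essential_supportE mu_nontrivial mu_moments mu_coef a_cvg a_gt0 b_cvg).
have [ba bb] := (bounded_variation_coefficients_bv _ _).1 ab_bv.
move=> k x gamma _ xout mu_k.
have xb j : 2 * a < `|x j - b|.
  by have := xout j; rewrite in_itv /= -ler_distl -ltNge.
have [fm [p [a' [b' [onp rec [a'a b'b] [ba' bb']]]]]] :=
  add_point_masses_recurrence mu_nontrivial mu_moments mu_coef a_cvg a_gt0 b_cvg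
    ba bb (fun=> erefl _ : mu_k _ = _) xb.
(* Positive definiteness for [mu_k] comes from the orthonormal system already constructed. *)
have onk := orthonormal_orthonormal_poly (orthonormal_posdef onp).
have pE : p = orthonormal_poly mu_k by apply/funext; exact: orthonormal_unique onp onk.
rewrite pE in onp rec.
split; first by exists a', b'.
move=> at_ bt_ rect.
(* Recurrence coefficients are determined from index 1 on only, so limits and variation are
   transferred through shifted sequences. *)
have atE n : at_ n.+1 = a' n.+1.
  by rewrite (three_term_coefE onp n rect).1 (three_term_coefE onp n rec).1.
have btE n : bt_ n.+1 = b' n.+1.
  by rewrite (three_term_coefE onp n rect).2 (three_term_coefE onp n rec).2.
split.
- by rewrite -cvg_shiftS (funext atE) cvg_shiftS.
- by rewrite -cvg_shiftS (funext btE) cvg_shiftS.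
apply/bounded_variation_coefficients_bv; split; apply: bvSr.
  by apply: eq_bv atE _; exact: bvS.
by apply: eq_bv btE _; exact: bvS.
Qed.
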